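(* Let $A$ be an Artin algebra of representation dimension at most three. Then $A$ satisfies the Auslander--Reiten conjecture: every finitely generated left $A$-module $M$ with $\operatorname{Ext}_A^i(M,M\oplus A)=0$ for all $i>0$ is projective.
   Context: An Artin algebra is an algebra $A$ over a commutative Artinian ring $R$ that is finitely generated as an $R$-module. All modules are finitely generated left modules. For a module $G$, $\operatorname{add}G$ is the full subcategory of direct summands of finite direct sums of copies of $G$. A module $G$ is a generator-cogenerator if every indecomposable projective module and every indecomposable injective module belongs to $\operatorname{add}G$. The representation dimension of $A$ is the infimum of the global dimensions of $\operatorname{End}_A(G)^{\mathrm{op}}$ over all generator-cogenerators $G$. *)

(* Defs.v *)
From HB Require Import structures.
From mathcomp Require Import all_boot all_order all_algebra.
From mathcomp Require Import boolp classical_sets functions constructive_ereal.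

Set Implicit Arguments.
Unset Strict Implicit.
Unset Printing Implicit Defensive.

Import Order.TTheory GRing.Theory Num.Theory.

Local Open Scope classical_set_scope.
Local Open Scope ring_scope.

Definition artinian (R : comPzRingType) : Prop :=
  forall I : nat -> set R^o,
    (forall n, submod_closed [in I n]) ->
    (forall n, I n.+1 `<=` I n) ->
    exists n, forall m, (n <= m)%N -> I m = I n.

(* The R-algebra structure on A is the central ring morphism phi, rather than
   an [algType R], so that the zero algebra is not excluded. *)
Definition artin_algebra (R : comPzRingType) (A : pzRingType)
    (phi : {rmorphism R -> A}) : Prop :=
  [/\ artinian R,
      forall r a, phi r * a = a * phi r
    & exists n (g : 'I_n -> A), forall a,
        exists c : 'I_n -> R, a = \sum_i phi (c i) * g i].

Section Modules.
Variable A : pzRingType.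
Implicit Types M N P E G X Y : lmodType A.

Definition fin_gen M : Prop :=
  exists n (g : 'I_n -> M), forall x, exists c : 'I_n -> A,
    x = \sum_i c i *: g i.

Definition zero_module M : Prop := forall x : M, x = 0.

Definition isomorphic M N : Prop := exists f : {linear M -> N}, bijective f.

Definition projective P : Prop :=
  forall X Y (p : {linear X -> Y}) (f : {linear P -> Y}),
    (forall y, exists x, p x = y) ->
    exists h : {linear P -> X}, forall x, p (h x) = f x.

Definition injective_module E : Prop :=
  forall X Y (j : {linear X -> Y}) (f : {linear X -> E}),
    injective j ->
    exists h : {linear Y -> E}, forall x, h (j x) = f x.

Definition indecomposable M : Prop :=
  ~ zero_module M /\
  forall X Y, isomorphic M (X * Y)%type -> zero_module X \/ zero_module Y.

Definition in_add G M : Prop :=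
  exists n N, isomorphic {ffun 'I_n -> G} (M * N)%type.

Definition generator_cogenerator G : Prop :=
  [/\ fin_gen G,
      forall P, fin_gen P -> indecomposable P -> projective P -> in_add G P
    & forall E, fin_gen E -> indecomposable E -> injective_module E ->
        in_add G E].

Record proj_resolution M := ProjResolution {
  res_obj :> nat -> lmodType A;
  res_diff : forall n, {linear res_obj n.+1 -> res_obj n};
  res_aug : {linear res_obj 0 -> M};
  res_fin_gen : forall n, fin_gen (res_obj n);
  res_projective : forall n, projective (res_obj n);
  res_aug_surj : forall y, exists x, res_aug x = y;
  res_exact0 : forall x, res_aug x = 0 <-> exists y, res_diff 0 y = x;
  res_exact : forall n x, res_diff n x = 0 <-> exists y, res_diff n.+1 y = x
}.

Definition proj_dim M : \bar int :=
  infimum +oo%E [set n%:Z%:E | n in [set n | exists P : proj_resolution M,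
    forall i, (n < i)%N -> zero_module (P i)]].

Definition ext_cocycle M N (P : proj_resolution M) i (f : {linear P i -> N}) :
    Prop :=
  forall x, f (res_diff P i x) = 0.

Definition ext_coboundary M N (P : proj_resolution M) i :
    {linear P i -> N} -> Prop :=
  match i with
  | 0%N => fun f => forall x, f x = 0
  | j.+1 => fun f => exists g : {linear P j -> N},
      forall x, f x = g (res_diff P j x)
  end.

(* Ext^i(M, N) = H^i(Hom(P, N)) = 0; this does not depend on the resolution. *)
Definition ext_vanishes i M N : Prop :=
  exists P : proj_resolution M,
    forall f : {linear P i -> N}, ext_cocycle f -> ext_coboundary f.

End Modules.

Definition global_dim (A : pzRingType) : \bar int :=
  supremum 0%E [set d | exists2 M : lmodType A, fin_gen M & d = proj_dim M].

Section EndomorphismRing.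
Variables (A : pzRingType) (G : lmodType A).

Definition endo : Type := {linear G -> G}.
Implicit Types f g h : endo.

Lemma endoP f g : (f : G -> G) =1 (g : G -> G) -> f = g.
Proof.
case: f g => [f [[f0] [f1]]] [g [[g0] [g1]]] /= /funext fg.
case: _ / fg in g0 g1 *.
by rewrite (Prop_irrelevance f0 g0) (Prop_irrelevance f1 g1).
Qed.

HB.instance Definition _ := gen_eqMixin endo.
HB.instance Definition _ := gen_choiceMixin endo.

Definition endo0 : endo := \0.
Definition endo1 : endo := idfun.
Definition endoN f : endo := GRing.opp_fun f.
Definition endoD f g : endo := f \+ g.
Definition endoM f g : endo := f \o g.

Fact endoDA : associative endoD.
Proof. by move=> f g h; apply: endoP => x /=; rewrite addrA. Qed.
Fact endoDC : commutative endoD.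
Proof. by move=> f g; apply: endoP => x /=; rewrite addrC. Qed.
Fact endo0D : left_id endo0 endoD.
Proof. by move=> f; apply: endoP => x /=; rewrite add0r. Qed.
Fact endoND : left_inverse endo0 endoN endoD.
Proof. by move=> f; apply: endoP => x /=; rewrite addNr. Qed.
HB.instance Definition _ :=
  GRing.isZmodule.Build endo endoDA endoDC endo0D endoND.

Fact endoMA : associative endoM.
Proof. by move=> f g h; apply: endoP. Qed.
Fact endo1M : left_id endo1 endoM.
Proof. by move=> f; apply: endoP. Qed.
Fact endoM1 : right_id endo1 endoM.
Proof. by move=> f; apply: endoP. Qed.
Fact endoMDl : left_distributive endoM +%R.
Proof. by move=> f g h; apply: endoP. Qed.
Fact endoMDr : right_distributive endoM +%R.
Proof. by move=> f g h; apply: endoP => x /=; rewrite linearD. Qed.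
HB.instance Definition _ :=
  GRing.Zmodule_isPzRing.Build endo endoMA endo1M endoM1 endoMDl endoMDr.

End EndomorphismRing.

(* [_^c] is the opposite ring. *)
Definition rep_dim (A : pzRingType) : \bar int :=
  infimum +oo%E [set d | exists2 G : lmodType A,
    generator_cogenerator G & d = global_dim (endo G)^c].

(* Main.v *)
Require Import Defs.
From Stdlib Require List.
From HB Require Import structures.
From mathcomp Require Import all_boot all_order all_algebra.
From mathcomp Require Import boolp classical_sets constructive_ereal.

(** Fix a projective resolution P of M with syzygies Omega^k M, and a module G
    in the definition of the representation dimension with End(G)^op of global
    dimension at most three. As Ext^i(M, A) = 0 for i > 0, dimension shifting
    turns Ext^i(M, M) = 0 into Ext^j(M, Omega^k M) = 0 for j > k ([ext0_ses]).
    On the other hand the identity of Omega^k M defines a class in Ext^k(M,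
    Omega^k M), and if it vanishes then Omega^k M is a summand of P_(k-1)
    ([syz_split]).

    For k >= 2 the module Hom(G, Omega^k M) is a second syzygy over End(G)^op,
    so its projective dimension is at most one, which yields an exact sequence
    0 -> L -> G^n -> Omega^k M -> 0 with L in add G ([add_resolution]). Hence
    the map Ext^j(M, L) -> Ext^j(M, G^n) is bijective for j > k + 1 and
    surjective for j = k + 1; it is injective for j = k + 1 as soon as both
    sides have the same length, and then the identity of Omega^k M lifts to G^n
    ([syz_retract]).

    To compare lengths, let e_j(X) be the length of Ext^j(M, X) over R, which
    is finite because R has finite length as a module over itself
    ([artinian_fin_len]). By the Krull-Schmidt theorem, e_j is determined on
    add G by its values on the finitely many indecomposable summands of G
    ([add_finite_rank]), so the e_j form a sequence in a finite-dimensional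
    vector space. The spans of its tails become constant ([rank_stationary]):
    for large j, a combination of modules of add G on which all later e_i
    vanish is also killed by e_j. Since e_j(L) = e_j(G^n) for j > k + 1, this
    gives e_(k+1)(L) = e_(k+1)(G^n) for large k, and Omega^k M belongs to add
    G.

    Now e_j(Omega^k M) = 0 for j > k, so by the same principle e_k(Omega^k M) =
    0 for large k, and Omega^k M is projective. The sequences 0 -> Omega^(k+1)
    M -> P_k -> Omega^k M -> 0 split one after the other, since Ext^(k+1)(M, -)
    vanishes on projectives, and M itself is projective. *)

Set Implicit Arguments.
Unset Strict Implicit.
Unset Printing Implicit Defensive.

Import Order.TTheory GRing.Theory Num.Theory.

Local Open Scope classical_set_scope.
Local Open Scope ring_scope.

(** * Linear maps, submodules and quotients *)

Section LinearMaps.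
Variable S : pzRingType.

Definition lin_of (U V : lmodType S) (f : U -> V) (fL : linear f) :
    {linear U -> V} :=
  HB.pack f (GRing.isLinear.Build S U V *:%R f fL).

Lemma linP (U V : lmodType S) (f g : {linear U -> V}) : f =1 g -> f = g.
Proof.
case: f g => [f [[f0] [f1]]] [g [[g0] [g1]]] /= /funext fg.
case: _ / fg in g0 g1 *.
by rewrite (Prop_irrelevance f0 g0) (Prop_irrelevance f1 g1).
Qed.

Fact inl_linear (U V : lmodType S) : linear (fun x : U => (x, 0 : V)).
Proof. by move=> a x y; congr pair; rewrite /= ?scaler0 ?addr0. Qed.
Fact inr_linear (U V : lmodType S) : linear (fun y : V => (0 : U, y)).
Proof. by move=> a x y; congr pair; rewrite /= ?scaler0 ?addr0. Qed.
Fact fst_linear (U V : lmodType S) : linear (fun x : (U * V)%type => x.1).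
Proof. by []. Qed.
Fact snd_linear (U V : lmodType S) : linear (fun x : (U * V)%type => x.2).
Proof. by []. Qed.

Definition inl_lin (U V : lmodType S) : {linear U -> (U * V)%type} :=
  lin_of (@inl_linear U V).
Definition inr_lin (U V : lmodType S) : {linear V -> (U * V)%type} :=
  lin_of (@inr_linear U V).
Definition fst_lin (U V : lmodType S) : {linear (U * V)%type -> U} :=
  lin_of (@fst_linear U V).
Definition snd_lin (U V : lmodType S) : {linear (U * V)%type -> V} :=
  lin_of (@snd_linear U V).

Fact comb_linear (I : Type) (r : seq I) (U V : lmodType S)
    (f : I -> {linear U -> V}) : linear (fun x => \sum_(i <- r) f i x).
Proof.
move=> a x y; rewrite scaler_sumr -big_split /=.
by apply: eq_bigr => i _; rewrite linearP.
Qed.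

Fact scale_linear (V : lmodType S) (x : V) : linear (fun c : S^o =>
  (c : S) *: x).
Proof. by move=> a c d; rewrite scalerDl scalerA. Qed.
Definition scale_lin (V : lmodType S) (x : V) : {linear S^o -> V} :=
  lin_of (scale_linear x).

Definition submodule (V : lmodType S) (U : set V) :=
  U 0 /\ forall a x y, U x -> U y -> U (a *: x + y).

Record submod_elt (V : lmodType S) (U : set V) : Type :=
  Submod { submod_val : V; submod_in : U submod_val }.

(** The proof that U is a submodule is an argument of the type so that the
    module structure can be inferred from the type. *)
Definition submod (V : lmodType S) (U : set V) (_ : submodule U) : Type :=
  submod_elt U.

Definition to_submod (V : lmodType S) (U : set V) (sU : submodule U) (x : V)
  (Ux : U x) : submod sU := Submod Ux.

(** The quotient by U consists of chosen representatives, one in each coset. *)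
Definition coset_rep (V : lmodType S) (U : set V) (x : V) : V :=
  xget 0 [set y | U (x - y)].

Record coset_elt (V : lmodType S) (U : set V) : Type :=
  Coset { quot_rep : V; quot_repK : coset_rep U quot_rep = quot_rep }.

Definition quotmod (V : lmodType S) (U : set V) (_ : submodule U) : Type :=
  coset_elt U.

Section Submodule.
Variables (V : lmodType S) (U : set V).
Hypothesis sU : submodule U.
Local Notation submod := (submod sU).
Local Notation quotmod := (quotmod sU).
Local Notation coset_rep := (coset_rep U).

Lemma sub0 : U 0. Proof. by case: sU. Qed.
Lemma subP a x y : U x -> U y -> U (a *: x + y).
Proof.
by case: sU => _; apply.
Qed.
Lemma subZ a x : U x -> U (a *: x).
Proof.
by move=> Ux; rewrite -[_ *: _]addr0; apply: subP => //; apply: sub0.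
Qed.
Lemma subD x y : U x -> U y -> U (x + y).
Proof. by move=> Ux Uy; rewrite -[x]scale1r; apply: subP. Qed.
Lemma subN x : U x -> U (- x).
Proof. by move=> Ux; rewrite -scaleN1r; apply: subZ. Qed.
Lemma subB x y : U x -> U y -> U (x - y).
Proof. by move=> Ux Uy; apply: subD => //; apply: subN. Qed.
Lemma sub_sum (I : Type) (r : seq I) (F : I -> V) :
  (forall i, U (F i)) -> U (\sum_(i <- r) F i).
Proof.
move=> UF; elim: r => [|i r IH]; first by rewrite big_nil; apply: sub0.
by rewrite big_cons; apply: subD.
Qed.

Lemma submod_inj (x y : submod) : submod_val x = submod_val y -> x = y.
Proof.
case: x y => [x Ux] [y Uy] /= exy; case: _ / exy in Uy *.
by rewrite (Prop_irrelevance Ux Uy).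
Qed.

HB.instance Definition _ := gen_eqMixin submod.
HB.instance Definition _ := gen_choiceMixin submod.

Definition submod0 : submod := Submod sub0.
Definition submodN (x : submod) : submod := Submod (subN (submod_in x)).
Definition submodD (x y : submod) : submod :=
  Submod (subD (submod_in x) (submod_in y)).
Definition submodZ a (x : submod) : submod := Submod (subZ a (submod_in x)).

Fact submodDA : associative submodD.
Proof. by move=> x y z; apply: submod_inj; rewrite /= addrA. Qed.
Fact submodDC : commutative submodD.
Proof. by move=> x y; apply: submod_inj; rewrite /= addrC. Qed.
Fact submod0D : left_id submod0 submodD.
Proof. by move=> x; apply: submod_inj; rewrite /= add0r. Qed.
Fact submodND : left_inverse submod0 submodN submodD.
Proof. by move=> x; apply: submod_inj; rewrite /= addNr. Qed.
HB.instance Definition _ :=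
  GRing.isZmodule.Build submod submodDA submodDC submod0D submodND.

Fact submodZA a b x : submodZ a (submodZ b x) = submodZ (a * b) x.
Proof. by apply: submod_inj; rewrite /= scalerA. Qed.
Fact submodZ1 : left_id 1 submodZ.
Proof. by move=> x; apply: submod_inj; rewrite /= scale1r. Qed.
Fact submodZDr : right_distributive submodZ +%R.
Proof. by move=> a x y; apply: submod_inj; rewrite /= scalerDr. Qed.
Fact submodZDl x : {morph submodZ^~ x : a b / a + b}.
Proof. by move=> a b; apply: submod_inj; rewrite /= scalerDl. Qed.
HB.instance Definition _ := GRing.Zmodule_isLmodule.Build S submod
  submodZA submodZ1 submodZDr submodZDl.

Fact submod_val_linear : linear (fun x : submod => submod_val x).
Proof.
by [].
Qed.
Definition submod_lin : {linear submod -> V} := lin_of submod_val_linear.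

Lemma submod_corestrict (X : lmodType S) (f : {linear X -> V}) :
  (forall x, U (f x)) ->
  exists g : {linear X -> submod}, forall x, submod_val (g x) = f x.
Proof.
move=> Uf; have gL : linear (fun x => Submod (Uf x) : submod).
  by move=> a x y; apply: submod_inj; rewrite /= linearP.
by exists (lin_of gL).
Qed.

Lemma coset_repP x : U (x - coset_rep x).
Proof.
rewrite /coset_rep; case: xgetP => [y _ //|/(_ x)]; case=> /=.
by rewrite subrr; apply: sub0.
Qed.

Lemma coset_rep_eq x y : U (x - y) -> coset_rep x = coset_rep y.
Proof.
move=> Uxy; congr xget; apply/funext => z; apply/propext; split=> /= Uz.
  have -> : y - z = (x - z) - (x - y) by rewrite opprB [RHS]addrC addrA subrK.
  exact: subB.
have -> : x - z = (x - y) + (y - z) by rewrite addrA subrK.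
exact: subD.
Qed.

Lemma quot_inj (x y : quotmod) : quot_rep x = quot_rep y -> x = y.
Proof.
case: x y => [x Ux] [y Uy] /= exy; case: _ / exy in Uy *.
by rewrite (Prop_irrelevance Ux Uy).
Qed.

Lemma coset_rep_idem x : coset_rep (coset_rep x) = coset_rep x.
Proof.
apply: coset_rep_eq; rewrite -opprB; apply: subN; exact: coset_repP.
Qed.

Definition quot_pi (x : V) : quotmod   := Coset (coset_rep_idem x).

Lemma quot_piP x y : quot_pi x = quot_pi y <-> U (x - y).
Proof.
split=> [[exy]|Uxy]; last by apply: quot_inj => /=; apply: coset_rep_eq.
have := subB (coset_repP x) (coset_repP y).
by rewrite exy opprB addrA subrK.
Qed.

Lemma quot_piK (x : quotmod) : quot_pi (quot_rep x) = x.
Proof. by apply: quot_inj; rewrite /= quot_repK. Qed.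

HB.instance Definition _ := gen_eqMixin quotmod.
HB.instance Definition _ := gen_choiceMixin quotmod.

Definition quot0 : quotmod := quot_pi 0.
Definition quotN (x : quotmod) : quotmod := quot_pi (- quot_rep x).
Definition quotD (x y : quotmod) : quotmod := quot_pi (quot_rep x + quot_rep y).
Definition quotZ a (x : quotmod) : quotmod := quot_pi (a *: quot_rep x).

Lemma quotDE x y : quotD (quot_pi x) (quot_pi y) = quot_pi (x + y).
Proof.
apply/quot_piP; rewrite -opprB; apply: subN.
have -> : x + y - (coset_rep x + coset_rep y)
        = (x - coset_rep x) + (y - coset_rep y) by rewrite addrACA opprD.
by apply: subD; apply: coset_repP.
Qed.
Lemma quotNE x : quotN (quot_pi x) = quot_pi (- x).
Proof. by apply/quot_piP; rewrite opprK addrC; apply: coset_repP. Qed.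
Lemma quotZE a x : quotZ a (quot_pi x) = quot_pi (a *: x).
Proof.
apply/quot_piP; rewrite -scalerBr; apply: subZ.
by rewrite -opprB; apply: subN; apply: coset_repP.
Qed.

Fact quotDA : associative quotD.
Proof.
move=> x y z; rewrite -(quot_piK x) -(quot_piK y) -(quot_piK z).
by rewrite !quotDE addrA.
Qed.
Fact quotDC : commutative quotD.
Proof. by move=> x y; rewrite /quotD addrC. Qed.
Fact quot0D : left_id quot0 quotD.
Proof. by move=> x; rewrite -(quot_piK x) quotDE add0r. Qed.
Fact quotND : left_inverse quot0 quotN quotD.
Proof. by move=> x; rewrite -(quot_piK x) quotNE quotDE addNr. Qed.
HB.instance Definition _ :=
  GRing.isZmodule.Build quotmod quotDA quotDC quot0D quotND.

Lemma quot_piD x y : quot_pi x + quot_pi y = quot_pi (x + y).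
Proof. exact: quotDE. Qed.

Fact quotZA a b x : quotZ a (quotZ b x) = quotZ (a * b) x.
Proof. by rewrite -(quot_piK x) !quotZE scalerA. Qed.
Fact quotZ1 : left_id 1 quotZ.
Proof. by move=> x; rewrite -(quot_piK x) !quotZE scale1r. Qed.
Fact quotZDr : right_distributive quotZ +%R.
Proof.
move=> a x y; rewrite -(quot_piK x) -(quot_piK y).
by rewrite quot_piD !quotZE quot_piD scalerDr.
Qed.
Fact quotZDl x : {morph quotZ^~ x : a b / a + b}.
Proof.
by move=> a b; rewrite -(quot_piK x) !quotZE quot_piD scalerDl.
Qed.
HB.instance Definition _ := GRing.Zmodule_isLmodule.Build S quotmod
  quotZA quotZ1 quotZDr quotZDl.

Fact quot_pi_linear : linear quot_pi.
Proof. by move=> a x y; rewrite -quot_piD -[quot_pi (a *: x)]quotZE. Qed.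
Definition quot_lin : {linear V -> quotmod} := lin_of quot_pi_linear.

Lemma quot_lin_eq0 x : quot_lin x = 0 <-> U x.
Proof. by rewrite -{2}[x]subr0; apply: quot_piP. Qed.

End Submodule.

Lemma ker_submodule (U V : lmodType S) (f : {linear U -> V}) :
  submodule [set x | f x = 0].
Proof.
split=> [|a x y]; first exact: linear0.
by rewrite /= linearP => -> ->; rewrite scaler0 addr0.
Qed.

Lemma range_submodule (U V : lmodType S) (f : {linear U -> V}) :
  submodule [set y | exists x, f x = y].
Proof.
split=> [|a _ _ [x <-] [y <-]]; first by exists 0; rewrite linear0.
by exists (a *: x + y); rewrite linearP.
Qed.

Lemma factor_surj (X Y W : lmodType S) (p : {linear X -> Y})
    (f : {linear X -> W}) :
  (forall y, exists x, p x = y) -> (forall x, p x = 0 -> f x = 0) ->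
  exists g : {linear Y -> W}, forall x, g (p x) = f x.
Proof.
move=> /choice[s ps] pf.
have sE x y : p x = p y -> f x = f y.
  by move=> pxy; apply/eqP; rewrite -subr_eq0 -linearB pf // linearB pxy subrr.
have gL : linear (fun y => f (s y)).
  by move=> a x y; rewrite -linearP; apply: sE; rewrite linearP !ps.
by exists (lin_of gL) => x /=; apply: sE.
Qed.

Lemma factor_inj (X Y W : lmodType S) (i : {linear Y -> W})
    (f : {linear X -> W}) :
  injective i -> (forall x, exists y, i y = f x) ->
  exists g : {linear X -> Y}, forall x, i (g x) = f x.
Proof.
move=> ii /choice[g ig].
have gL : linear g by move=> a x y; apply: ii; rewrite linearP !ig linearP.
by exists (lin_of gL).
Qed.

Lemma linear_inj (U V : lmodType S) (f : {linear U -> V}) :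
  (forall x, f x = 0 -> x = 0) -> injective f.
Proof.
move=> f0 x y fxy; apply/eqP; rewrite -subr_eq0; apply/eqP/f0.
by rewrite linearB fxy subrr.
Qed.

(** The image of f is only required to lie in the image of p, which is itself a
    module onto which p is surjective. *)
Lemma proj_lift (P X Y : lmodType S) (p : {linear X -> Y})
    (f : {linear P -> Y}) :
  projective P -> (forall x, exists y, p y = f x) ->
  exists h : {linear P -> X}, forall x, p (h x) = f x.
Proof.
move=> pP fp.
have sR := range_submodule p.
have [p' p'E] := submod_corestrict sR (f := p) (fun x => ex_intro _ x erefl).
have [f' f'E] := submod_corestrict sR fp.
have [|h hE] := pP _ _ p' f'.
  move=> [y [x xy]]; exists x; apply: submod_inj; rewrite p'E; exact: xy.
by exists h => x; rewrite -p'E hE f'E.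
Qed.

Lemma isom_sym (M N : lmodType S) : isomorphic M N -> isomorphic N M.
Proof.
move=> [f [g fK gK]].
have gL : linear g by move=> a x y; apply: (can_inj fK); rewrite linearP !gK.
by exists (lin_of gL); exists f.
Qed.

Lemma isom_of_bij (M N : lmodType S) (f : {linear M -> N}) :
  (forall x, f x = 0 -> x = 0) -> (forall y, exists x, f x = y) ->
  isomorphic M N.
Proof.
move=> /linear_inj fi /choice[g gK]; exists f; exists g => // x.
by apply: fi; rewrite gK.
Qed.

Definition retract (Y Z : lmodType S) :=
  exists (s : {linear Y -> Z}) (p : {linear Z -> Y}), forall x, p (s x) = x.

Lemma retract_trans (X Y Z : lmodType S) :
  retract X Y -> retract Y Z -> retract X Z.
Proof.
move=> [s [p ps]] [t [q qt]]; exists (t \o s), (p \o q) => x /=.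
by rewrite qt ps.
Qed.

Lemma isom_retract (Y Z : lmodType S) : isomorphic Y Z -> retract Y Z.
Proof.
move=> [f [g fK gK]].
have gL : linear g by move=> a x y; apply: (can_inj fK); rewrite linearP !gK.
by exists f, (lin_of gL).
Qed.

Lemma retract_fst (X Y Z : lmodType S) : isomorphic X (Y * Z)%type ->
  retract Y X.
Proof.
move=> h; apply: retract_trans (isom_retract (isom_sym h)).
by exists (inl_lin Y Z), (fst_lin Y Z).
Qed.

Lemma retract_snd (X Y Z : lmodType S) : isomorphic X (Y * Z)%type ->
  retract Z X.
Proof.
move=> h; apply: retract_trans (isom_retract (isom_sym h)).
by exists (inr_lin Y Z), (snd_lin Y Z).
Qed.

Lemma retract_split (Y Z : lmodType S) (s : {linear Y -> Z}) (p : {linear Z -> Y}) :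
  (forall x, p (s x) = x) ->
  isomorphic Z (Y * submod (ker_submodule p))%type.
Proof.
move=> ps; apply: isom_sym.
pose f := (s \o fst_lin _ _) \+ (submod_lin (ker_submodule p) \o snd_lin _ _).
apply: (@isom_of_bij _ _ f) => [[y k] /= f0|z].
  have y0 : y = 0.
    have := congr1 p f0; rewrite linearD ps linear0.
    by rewrite (submod_in k) addr0.
  move: f0; rewrite y0 linear0 add0r => k0; congr pair.
  exact: submod_inj.
have kz : p (z - s (p z)) = 0 by rewrite linearB ps subrr.
by exists (p z, to_submod (ker_submodule p) kz) => /=; rewrite addrC subrK.
Qed.

Lemma retract_projective (Y Z : lmodType S) : retract Y Z -> projective Z ->
  projective Y.
Proof.
move=> [s [p ps]] pZ X X' q f qs.
have [h hE] := pZ _ _ q (f \o p) qs.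
by exists (h \o s) => x /=; rewrite hE /= ps.
Qed.

Lemma surj_fin_gen (Y Z : lmodType S) (p : {linear Z -> Y}) :
  (forall y, exists x, p x = y) -> fin_gen Z -> fin_gen Y.
Proof.
move=> ps [n [g gP]]; exists n, (p \o g) => y.
have [x <-] := ps y; have [c ->] := gP x; exists c.
by rewrite linear_sum; apply: eq_bigr => i _; rewrite linearZ.
Qed.

Lemma retract_fin_gen (Y Z : lmodType S) : retract Y Z -> fin_gen Z ->
  fin_gen Y.
Proof.
by move=> [s [p ps]]; apply: (surj_fin_gen (p := p)) => y; exists (s y).
Qed.

End LinearMaps.

(** * Length of subquotients *)

Section Length.
Variable S : pzRingType.

Section Chains.
Variable V : lmodType S.
Implicit Types U W T : set V.

(** Chains T_1 < ... < T_n < U of submodules above W, with n strict steps.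
    Lengths are attached to a pair of submodules W, U rather than to the
    quotient U / W, so that the length of a subquotient (an Ext group, for
    instance) can be handled inside the ambient module. *)
Fixpoint chain W n U : Prop :=
  if n is m.+1 then
    exists T, [/\ submodule T, chain W m T, T `<=` U & exists2 x, U x & ~ T x]
  else W `<=` U.

Definition fin_len W U := exists N, forall n, chain W n U -> (n <= N)%N.

(** The length of U / W, with 0 as default value when chains are unbounded. *)
Definition len W U : nat :=
  xget 0%N [set n | chain W n U /\ forall m, chain W m U -> (m <= n)%N].

Lemma chain_sub W n U : chain W n U -> W `<=` U.
Proof.
elim: n U => //= n IH U [T [_ /IH WT TU _]]; exact: subset_trans TU.
Qed.

Lemma chain_mono W n U U' : U `<=` U' -> chain W n U -> chain W n U'.
Proof.
case: n => [|n] UU' /=; first by move=> WU; apply: subset_trans UU'.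
move=> [T [sT WT TU [x Ux Tx]]]; exists T; split=> //.
  exact: subset_trans UU'.
by exists x => //; apply: UU'.
Qed.

Lemma chain_cat W T U n m : chain W n T -> chain T m U -> chain W (n + m) U.
Proof.
move=> WT; elim: m U => [|m IH] U /=; first by rewrite addn0 => TU;
  apply: chain_mono WT.
by rewrite addnS => -[T' [sT' /IH cT' TU U']]; exists T'.
Qed.

Definition sum_set U T : set V := [set z | exists u t, [/\ U u, T t &
  z = u + t]].

Lemma sum_submodule U T : submodule U -> submodule T -> submodule (sum_set U T).
Proof.
move=> sU sT; split.
  by exists 0, 0; split; [apply: sub0|apply: sub0|rewrite addr0].
move=> a _ _ [u [t [Uu Tt ->]]] [u' [t' [Uu' Tt' ->]]].
exists (a *: u + u'), (a *: t + t'); split; [exact: subP|exact: subP|].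
by rewrite scalerDr addrACA.
Qed.

Lemma cap_submodule U T : submodule U -> submodule T -> submodule (U `&` T).
Proof.
move=> sU sT; split; first by split; apply: sub0.
by move=> a x y [Ux Tx] [Uy Ty]; split; apply: subP.
Qed.

(** By the modular law a step of a chain that is strict stays strict after
    intersecting with T or after adding T. *)
Lemma chain_split W T U n : submodule U -> submodule T -> W `<=` T ->
  chain W n U -> exists a b, [/\ (n <= a + b)%N, chain W a (U `&` T)
                                & chain T b (sum_set U T)].
Proof.
move=> sU sT WT; elim: n U sU => [|n IH] U sU /=.
  move=> WU; exists 0%N, 0%N; split=> //= x; first by move=> Wx; split; auto.
  by move=> Tx; exists 0, x; split=> //; [apply: sub0|rewrite add0r].
move=> [U' [sU' cU' U'U [x Ux U'x]]].
have [a [b [nab ca cb]]] := IH U' sU' cU'.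
have [[y [Uy Ty] U'y]|nex] := pselect (exists2 y, (U `&` T) y & ~ U' y).
  exists a.+1, b; split; first by rewrite addSn.
    exists (U' `&` T); split=> //; first exact: cap_submodule.
      by move=> z [/U'U].
    by exists y => // -[].
  by apply: chain_mono cb => z [u [t [/U'U]]]; exists u, t.
exists a, b.+1; split; first by rewrite addnS.
  by apply: chain_mono ca => z [/U'U].
exists (sum_set U' T); split=> //; first exact: sum_submodule.
  by move=> z [u [t [/U'U]]]; exists u, t.
exists x; first by exists x, 0; split=> //; [apply: sub0|rewrite addr0].
move=> [u [t [U'u Tt xut]]]; apply: nex; exists t.
  split=> //; rewrite -[t](addKr u) -xut addrC.
  by apply: subB => //; apply: U'U.
by move=> U't; apply: U'x; rewrite xut; apply: subD.
Qed.

Lemma fin_len_cat W T U : submodule T -> submodule U -> W `<=` T -> T `<=` U ->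
  fin_len W T -> fin_len T U -> fin_len W U.
Proof.
move=> sT sU WT TU [N1 h1] [N2 h2]; exists (N1 + N2)%N => n cn.
have [a [b [nab ca cb]]] := chain_split sU sT WT cn.
apply: leq_trans nab _; apply: leq_add; [apply: h1|apply: h2].
  by apply: chain_mono ca => x [].
by apply: chain_mono cb => _ [u [t [Uu /TU Ut ->]]]; apply: subD.
Qed.

Lemma lenP W U : fin_len W U -> W `<=` U ->
  chain W (len W U) U /\ forall m, chain W m U -> (m <= len W U)%N.
Proof.
move=> [N hN] WU; rewrite /len; case: xgetP => [n -> //|no]; exfalso.
have ex0 : exists n, `[< chain W n U >] by exists 0%N; apply/asboolP.
have bnd n : `[< chain W n U >] -> (n <= N)%N by move/asboolP/hN.
case: (ex_maxnP ex0 bnd) => n /asboolP cn max; apply: (no n); split=> // m cm.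
by apply: max; apply/asboolP.
Qed.

Lemma fin_len_sub W U U' : U `<=` U' -> fin_len W U' -> fin_len W U.
Proof.
by move=> UU' [N hN]; exists N => n cn; apply: hN; apply: chain_mono cn.
Qed.

Lemma fin_len_super W W' U : submodule U -> submodule W' -> W `<=` W' ->
  W' `<=` U ->
  fin_len W U -> fin_len W' U.
Proof.
move=> sU sW' WW' W'U [N hN]; exists N => n cn; apply: hN.
by rewrite -[n]add0n; apply: chain_cat cn.
Qed.

Lemma len_add W T U : submodule T -> submodule U -> W `<=` T -> T `<=` U ->
  fin_len W U -> len W U = (len W T + len T U)%N.
Proof.
move=> sT sU WT TU fWU.
have WU : W `<=` U by exact: subset_trans TU.
have fWT : fin_len W T by apply: fin_len_sub fWU.
have fTU : fin_len T U by apply: fin_len_super fWU.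
have [cWU mWU] := lenP fWU WU.
have [cWT mWT] := lenP fWT WT.
have [cTU mTU] := lenP fTU TU.
apply/eqP; rewrite eqn_leq; apply/andP; split; last by apply/mWU/chain_cat/cTU.
have [a [b [nab ca cb]]] := chain_split sU sT WT cWU.
apply: leq_trans nab _; apply: leq_add; [apply: mWT|apply: mTU].
  by apply: chain_mono ca => x [].
by apply: chain_mono cb => _ [u [t [Uu /TU Ut ->]]]; apply: subD.
Qed.

Lemma len_eq0 W U : submodule W -> fin_len W U -> W `<=` U ->
  len W U = 0%N -> U `<=` W.
Proof.
move=> sW fWU WU l0 x Ux; apply: contrapT => nWx.
have [_ /(_ 1%N)] := lenP fWU WU; rewrite l0;
  suff h : chain W 1 U by move/(_ h).
by exists W; split=> //; exists x.
Qed.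

Lemma len_triv W U : U `<=` W -> len W U = 0%N.
Proof.
move=> UW; rewrite /len; case: xgetP =>
  // -[//|n] _ /= [[T [_ cT _ [x /UW Wx Tx]]] _].
by case: Tx; apply: (chain_sub cT).
Qed.

End Chains.

Section Maps.
Variables (V V' : lmodType S) (f : {linear V -> V'}).
Variables (W U : set V) (W' U' : set V').
Hypotheses (sW : submodule W) (sU : submodule U).
Hypotheses (sW' : submodule W') (sU' : submodule U').
Hypotheses (WU : W `<=` U) (WU' : W' `<=` U').
Hypothesis fU : forall x, U x -> U' (f x).
Hypothesis fW : forall x, W x -> W' (f x).

Lemma image_submodule (T : set V) : submodule T -> submodule (f @` T).
Proof.
move=> sT; split; first by exists 0; [apply: sub0|rewrite linear0].
move=> a _ _ [x Tx <-] [y Ty <-]; exists (a *: x + y); last by rewrite linearP.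
exact: subP.
Qed.

Lemma preimage_submodule (T : set V') : submodule T -> submodule (f @^-1` T).
Proof.
move=> sT; split; first by rewrite /preimage /= linear0; apply: sub0.
by move=> a x y; rewrite /preimage /= => Tx Ty; rewrite linearP; apply: subP.
Qed.

(** When f induces an injection U / W -> U' / W', distinct submodules above W
    have distinct images modulo W'. *)
Lemma chain_inj n : (forall x, U x -> W' (f x) -> W x) ->
  chain W n U -> chain W' n U'.
Proof.
move=> inj cn; apply: (@chain_mono _ _ _ (sum_set (f @` U) W')).
  by move=> _ [_ [w [[x Ux <-] Ww ->]]]; apply: subD => //;
    [apply: fU|apply: WU'].
suff gen : forall T, submodule T -> T `<=` U -> chain W n T ->
  chain W' n (sum_set (f @` T) W') by exact: gen.
elim: n {cn} => [|n IH] T sT TU.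
  move=> _ w W'w; exists 0, w; split=> //; last by rewrite add0r.
  by exists 0; [apply: sub0|rewrite linear0].
move=> [T' [sT' cT' T'T [x Tx T'x]]]; exists (sum_set (f @` T') W'); split.
- by apply: sum_submodule => //; apply: image_submodule.
- by apply: IH => //; apply: subset_trans TU.
- by move=> z [_ [w [[y T'y <-] W'w ->]]]; exists (f y), w; split=> //;
  exists y; auto.
exists (f x).
  exists (f x), 0; split; [by exists x|exact: sub0|by rewrite addr0].
move=> [_ [w [[y T'y <-] W'w fxy]]]; apply: T'x.
rewrite -(subrK y x); apply: subD => //; apply: (chain_sub cT').
apply: inj; first by apply: subB => //; apply: TU => //; apply: T'T.
by rewrite linearB fxy addrC addKr.
Qed.

Hypothesis surj : forall y, U' y -> exists2 u, U u & W' (y - f u).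

(** When f induces a surjection U / W -> U' / W', distinct submodules above W'
    have distinct preimages in U. *)
Lemma chain_surj n : chain W' n U' -> chain W n U.
Proof.
move=> cn; apply: (@chain_mono _ _ _ (U `&` f @^-1` U')); first by move=> x [].
suff gen : forall T, submodule T -> T `<=` U' -> chain W' n T ->
  chain W n (U `&` f @^-1` T) by exact: gen.
elim: n {cn} => [|n IH] T sT TU.
  by move=> W'T x Wx; split; [apply: WU|apply/W'T/fW].
move=> [T' [sT' cT' T'T [y Ty T'y]]]; exists (U `&` f @^-1` T'); split.
- by apply: cap_submodule => //; apply: preimage_submodule.
- by apply: IH => //; apply: subset_trans TU.
- by move=> z [Uz T'z]; split=> //; apply: T'T.
have [u Uu W'u] := surj (TU _ Ty).
have T'u := chain_sub cT' W'u.
exists u; first split=> //; rewrite /preimage /=.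
  by rewrite -[f u](subKr y); apply: subB => //; apply: T'T.
move=> [_ T'fu]; apply: T'y; rewrite -(subrK (f u) y); exact: subD.
Qed.

End Maps.

Section MapLength.
Variables (V V' : lmodType S) (f : {linear V -> V'}).
Variables (W U : set V) (W' U' : set V').
Hypotheses (sW : submodule W) (sU : submodule U).
Hypotheses (sW' : submodule W') (sU' : submodule U').
Hypotheses (WU : W `<=` U) (WU' : W' `<=` U').
Hypothesis fU : forall x, U x -> U' (f x).
Hypothesis fW : forall x, W x -> W' (f x).

Lemma fin_len_inj : (forall x, U x -> W' (f x) -> W x) ->
  fin_len W' U' -> fin_len W U.
Proof.
by move=> inj [N hN]; exists N => n cn; apply: hN; apply: (chain_inj (f :=
  f)) cn.
Qed.

Lemma len_inj : (forall x, U x -> W' (f x) -> W x) ->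
  fin_len W' U' -> (len W U <= len W' U')%N.
Proof.
move=> inj fl; have fl' := fin_len_inj inj fl.
have [c _] := lenP fl' WU; have [_] := lenP fl WU'; apply.
exact: (chain_inj (f := f)) c.
Qed.

Hypothesis surj : forall y, U' y -> exists2 u, U u & W' (y - f u).

Lemma fin_len_surj : fin_len W U -> fin_len W' U'.
Proof.
by move=> [N hN]; exists N => n cn; apply: hN; apply: (chain_surj (f := f)) cn.
Qed.

Lemma len_surj : fin_len W U -> (len W' U' <= len W U)%N.
Proof.
move=> fl; have fl' := fin_len_surj fl.
have [c _] := lenP fl' WU'; have [_] := lenP fl WU; apply.
exact: (chain_surj (f := f)) c.
Qed.

(** A surjection between subquotients of equal finite length is injective: U
    has at least the length of U' / W' over the preimage of W', which leaves
    length 0 for this preimage over W. *)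
Lemma len_surj_eq : fin_len W U -> len W' U' = len W U ->
  forall x, U x -> W' (f x) -> W x.
Proof.
move=> fl le x Ux W'x; pose T := U `&` f @^-1` W'.
have sT : submodule T by apply: cap_submodule => //; apply: preimage_submodule.
have WT : W `<=` T by move=> y Wy; split; [apply: WU|apply: fW].
have TU : T `<=` U by move=> y [].
have lT := len_add sT sU WT TU fl.
have fT : fin_len T U by apply: fin_len_super fl.
have l2 : (len W' U' <= len T U)%N.
  have fl' := fin_len_surj fl.
  have [c _] := lenP fl' WU'; have [_] := lenP fT TU; apply.
  by apply: (chain_surj (f := f)) c => //; move=> y [].
have l0 : len W T = 0%N.
  by apply/eqP; rewrite -leqn0 -(leq_add2r (len T U)) -lT -le add0n.
apply: (len_eq0 sW _ WT l0); last by split.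
exact: fin_len_sub fl.
Qed.

Lemma len_bij : (forall x, U x -> W' (f x) -> W x) -> fin_len W U ->
  len W U = len W' U'.
Proof.
move=> inj fl; apply/eqP; rewrite eqn_leq len_surj // andbT.
by apply: len_inj => //; apply: fin_len_surj.
Qed.

End MapLength.
End Length.

(** * Finite length over Artin algebras *)

Section Artinian.
Variable R : comPzRingType.
Hypothesis artR : artinian R.

(** The descending chain condition, in the form of minimal elements. *)
Lemma min_ideal (Q : set R^o -> Prop) :
  (exists I, submodule I /\ Q I) ->
  exists I, [/\ submodule I, Q I &
    forall J, submodule J -> Q J -> J `<=` I -> J = I].
Proof.
move=> [I0 I0P]; apply: contrapT => nomin.
pose T := {I : set R^o | submodule I /\ Q I}.
have step (I : T) : exists J : T, sval J `<=` sval I /\ sval J <> sval I.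
  case: I => I [sI QI]; apply: contrapT => noJ; apply: nomin; exists I;
    split=> //.
  move=> J sJ QJ JI; apply: contrapT => nJI; apply: noJ.
  by exists (exist _ J (conj sJ QJ)).
have [nx nxP] := choice step.
pose c n := iter n nx (exist _ I0 I0P : T).
have [||n /(_ n.+1 (leqnSn n))] := artR (I := fun n => sval (c n)).
- move=> n; have [[s0 sP] _] := svalP (c n); split; first exact: mem_set.
  by move=> a x y /set_mem Ux /set_mem Uy; apply/mem_set/sP.
- by move=> n; have [] := nxP (c n).
- by have [] := nxP (c n).
Qed.

Fact mul_linear (x : R) : linear (fun y : R^o => (x * y : R^o)).
Proof. by move=> a y z; rewrite mulrDr mulrCA. Qed.
Definition mul_lin (x : R) : {linear R^o -> R^o} := lin_of (mul_linear x).

(** Let I be minimal among the ideals of infinite length. Multiplication by an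
    element of R is zero or onto on I, and in the second case invertible, so I
    is a vector space over a field. Zorn's lemma gives a hyperplane W of I that
    avoids a vector v; being proper, W has finite length, hence so has I. *)
Lemma artinian_fin_len : fin_len [set 0] (setT : set R^o).
Proof.
apply: contrapT => nfl.
have sT : submodule (setT : set R^o) by [].
have s0 : submodule ([set 0] : set R^o).
  by split=> // a _ _ -> ->; rewrite scaler0 addr0.
have [|I [sI nI minI]] := min_ideal (Q := fun I => ~ fin_len [set 0] I).
  by exists setT.
have subI J : submodule J -> J `<=` I -> J <> I -> fin_len [set 0] J.
  by move=> sJ JI nJI; apply: contrapT => nfJ; apply/nJI/minI.
have zI (J : set R^o) : submodule J -> [set 0] `<=` J.
  by move=> sJ _ ->; apply: sub0.
(* The kernel and the image of x on I are submodules of I; if both were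
   proper they would have finite length, and so would I. *)
have act x : (forall i, I i -> x * i = 0) \/ (forall i, I i ->
  exists2 j, I j & x * j = i).
  pose K := I `&` [set i | mul_lin x i = 0].
  have sK : submodule K by apply: cap_submodule => //; apply: ker_submodule.
  have KI : K `<=` I by move=> i [].
  pose X := [set y | exists2 i, I i & mul_lin x i = y].
  have sX : submodule X by exact: image_submodule.
  have XI : X `<=` I by move=> _ [i Ii <-]; exact: (subZ sI x Ii).
  have [XeI|nXI] := pselect (X = I).
    by right=> i Ii; have : X i by rewrite XeI.
  have [KeI|nKI] := pselect (K = I).
    by left=> i Ii; have [] : K i by rewrite KeI.
  case: nI; apply: (@fin_len_cat _ _ _ K) => //; first exact: zI.
    exact: subI.
  apply: (@fin_len_inj _ _ _ (mul_lin x) _ _ [set 0] X) => //; first exact: zI.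
  - by move=> i Ii; exists i.
  - exact: subI.
(* The powers of x generate a stationary chain: x ^+ n = x ^+ n.+1 * y, and
   x ^+ n is onto I. *)
have inv x : (forall i, I i -> exists2 j, I j & x * j = i) ->
    exists y, forall i, I i -> y * (x * i) = i.
  move=> xI.
  pose J n : set R^o := [set z | exists y, z = x ^+ n * y].
  have [||n /(_ n.+1 (leqnSn n)) Jn] := artR (I := J).
  - move=> n; split; first by apply: mem_set; exists 0; rewrite mulr0.
    move=> a _ _ /set_mem[y ->] /set_mem[z ->]; apply: mem_set;
      exists (a * y + z).
    by rewrite mulrDr [_ *: _]mulrCA.
  - by move=> n _ [y ->]; exists (x * y); rewrite exprSr mulrA.
  have [y xy] : J n.+1 (x ^+ n) by rewrite Jn; exists 1; rewrite mulr1.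
  exists y => i Ii.
  have [j Ij <-] : exists2 j, I j & x ^+ n * j = i.
    elim: n {Jn xy} i Ii => [|n IH] i Ii; first by exists i;
      rewrite // expr0 mul1r.
    have [j Ij <-] := xI i Ii; have [k Ik <-] := IH j Ij.
    by exists k; rewrite // exprS mulrA.
  by rewrite {2}xy exprS !mulrA [y * x]mulrC -[x * y * _]mulrA [y * _]mulrC mulrA.
have [v Iv v0] : exists2 v, I v & v <> 0.
  apply: contrapT => nov; apply: nI; exists 0%N =>
    -[//|n] /= [T [sT' _ _ [x Ix nTx]]].
  by exfalso; apply: nov; exists x => // x0; apply: nTx; rewrite x0;
    apply: sub0.
(* Zero is added to W because Zorn's lemma also asks for the empty union. *)
pose P (W : set R^o) := [/\ submodule (W `|` [set 0]), W `<=` I & ~ W v].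
have [F FP Ftot|W0 [[sW W0I W0v] maxW0]] := @Zorn_bigcup _ P.
  split; last 1 first.
  - by move=> [W FW Wv]; have [_ _] := FP _ FW; apply.
  - split; first by right.
    move=> a x y [[W FW Wx]|->]; last first.
      by rewrite scaler0 add0r.
    have hW (W' : set R^o) : F W' -> W `<=` W' -> (W' `|` [set 0]) y ->
        ((\bigcup_(X in F) X) `|` [set 0]) (a *: x + y).
      move=> FW' WW' W'y; have [sW' _ _] := FP _ FW'.
      have [] := proj2 sW' a x y (or_introl (WW' _ Wx)) W'y; last by right.
      by left; exists W'.
    move=> [[W' FW' W'y]|y0]; last by apply: (hW W) => //; right.
    have [WW'|W'W] := Ftot _ _ FW FW'; first by apply: (hW W') => //; left.
    by apply: (hW W) => //; left; apply: W'W.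
  - by move=> x [W FW Wx]; have [_ WI _] := FP _ FW; apply: WI.
pose W := W0 `|` [set 0]; rewrite -/W in sW.
have WI : W `<=` I by move=> x [/W0I//|->]; apply: sub0.
have Wv : ~ W v by case.
have above T : submodule T -> W `<=` T -> T `<=` I -> (exists2 x, T x &
  ~ W x) -> T v.
  move=> sT1 WT TI [x Tx Wx]; apply: contrapT => Tv; apply: (maxW0 T);
    last first.
    split=> //; rewrite (_ : T `|` [set 0] = T) //.
    by apply/seteqP; split=> y; [case=> // ->; apply: sub0|left].
  split; first by move=> y W0y; apply: WT; left.
  by move=> /(_ x Tx) W0x; apply: Wx; left.
have scal c : c * v <> 0 -> exists y, forall i, I i -> y * (c * i) = i.
  by move=> cv; have [z|/inv//] := act c; case: cv; apply: z.
have gen u : I u -> exists2 w, W w & exists c, u = w + c * v.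
  move=> Iu; have [Wu|nWu] := pselect (W u).
    by exists u => //; exists 0; rewrite mul0r addr0.
  have sU : submodule (range (scale_lin (u : R^o))).
    exact: image_submodule.
  have [||||w [t [Ww [c _ <-] vE]]] :=
    above (sum_set W (range (scale_lin (u : R^o)))).
  - exact: sum_submodule.
  - by move=> w Ww; exists w, 0; split=> //; [exists 0 => //=;
    rewrite scale0r|rewrite addr0].
  - move=> _ [w [_ [Ww [c _ <-] ->]]]; apply: subD => //; first exact: WI.
    exact: subZ.
  - exists u => //; exists 0, u; split; [exact: sub0| |by rewrite add0r].
    by exists 1 => //=; rewrite scale1r.
  have [z|/inv[y yc]] := act c.
    by case: Wv; rewrite vE /= [c *: _]z ?addr0.
  exists (y * - w); first by apply: (subZ sW); exact: subN.
  by exists y; rewrite vE mulrDr mulrN addKr yc.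
apply: nI; apply: (@fin_len_cat _ _ _ W) => //; first exact: zI.
  by apply: subI => // WE; apply: Wv; rewrite WE.
exists 1%N => -[//|[//|n]] /= [T [sT1 [T' [sT' /chain_sub WT' T'T [x Tx T'x]]] TI [z Iz Tz]]].
have Tv : T v.
  apply: above => //; first exact: subset_trans T'T.
  by exists x => // /WT'.
have [w Ww [c zE]] := gen z Iz; case: Tz; rewrite zE; apply: subD => //.
  by apply/T'T/WT'.
exact: (subZ sT1).
Qed.

End Artinian.

Lemma submoduleT (S : pzRingType) (V : lmodType S) : submodule (setT : set V).
Proof. by []. Qed.

Section Span.
Variables (S : pzRingType) (V : lmodType S).

Fixpoint lspan (s : seq V) : set V :=
  if s is g :: s' then sum_set (range (scale_lin g)) (lspan s') else [set 0].

Lemma submodule0 : submodule ([set 0] : set V).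
Proof. by split=> // a _ _ -> ->; rewrite scaler0 addr0. Qed.

Lemma span_submodule s : submodule (lspan s).
Proof.
elim: s => [|g s IH] /=; first exact: submodule0.
apply: sum_submodule => //; apply: (image_submodule (scale_lin g) (T := setT));
  exact: submoduleT.
Qed.

Lemma mem_span s g : g \in s -> lspan s g.
Proof.
elim: s => //= h s IH; rewrite in_cons => /orP[/eqP->|/IH sg].
  exists h, 0; split; [|exact: sub0 (span_submodule s)|by rewrite addr0].
  by exists 1 => //=; rewrite scale1r.
exists 0, g; split=> //; last by rewrite add0r.
by exists 0 => //=; rewrite scale0r.
Qed.

Lemma span_fin_len s : fin_len [set 0] (setT : set S^o) ->
  fin_len [set 0] (lspan s).
Proof.
move=> flS; elim: s => [|g s IH].
  by exists 0%N => -[//|n] /= [T [sT _ _ [x -> []]]]; apply: sub0.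
have s0 : [set 0] `<=` lspan s by move=> _ ->; apply: (sub0 (span_submodule s)).
have le : lspan s `<=` lspan (g :: s).
  by move=> x sx; exists 0, x; split=> //; [exists 0 => //=;
    rewrite scale0r|rewrite add0r].
have ss := span_submodule s; have sg := span_submodule (g :: s).
apply: fin_len_cat IH _ => //.
apply: (@fin_len_surj _ _ _ (scale_lin g) [set 0] setT) => //.
  by move=> _ ->; rewrite linear0; apply: (sub0 ss).
by move=> _ [_ [y [[c _ <-] sy ->]]]; exists c => //; rewrite addrC addKr.
Qed.
End Span.

Lemma lspan_full_fin_len (S : pzRingType) (V : lmodType S) (s : seq V) :
  (forall x, lspan s x) -> fin_len [set 0] (setT : set S^o) ->
  fin_len [set 0] (setT : set V).
Proof.
by move=> sx flS; apply: fin_len_sub (span_fin_len s flS) => x _; apply: sx.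
Qed.

Lemma span_fin_gen (S : pzRingType) (V : lmodType S) (s : seq V) :
  (forall x, lspan s x) -> fin_gen V.
Proof.
move=> sx; exists (size s), (fun i => nth 0 s i) => x.
elim: s x {sx} (sx x) => [|g s IH] x /=.
  by move=> ->; exists (fun=> 0); rewrite big_ord0.
move=> [_ [y [[a _ <-] /IH[c ->] ->]]].
exists (fun i => if unlift ord0 i is Some j then c j else a).
rewrite big_ord_recl unlift_none; congr (_ + _).
by apply: eq_bigr => i _; rewrite liftK.
Qed.

Section Restriction.
Variables (R : comPzRingType) (A : pzRingType) (phi : {rmorphism R -> A}).

(** Restriction of scalars along phi. *)
Definition restr (X : lmodType A) : Type := X.
HB.instance Definition _ (X : lmodType A) := GRing.Zmodule.on (restr X).

Section RestrScale.
Variable X : lmodType A.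
Definition restr_scale (r : R) (x : restr X) : restr X := phi r *: (x : X).
Fact restr_scaleA a b x :
  restr_scale a (restr_scale b x) = restr_scale (a * b) x.
Proof. by rewrite /restr_scale scalerA rmorphM. Qed.
Fact restr_scale1 : left_id 1 restr_scale.
Proof. by move=> x; rewrite /restr_scale rmorph1 scale1r. Qed.
Fact restr_scaleDr : right_distributive restr_scale +%R.
Proof. by move=> a x y; rewrite /restr_scale scalerDr. Qed.
Fact restr_scaleDl x : {morph restr_scale^~ x : a b / a + b}.
Proof. by move=> a b; rewrite /restr_scale rmorphD scalerDl. Qed.
HB.instance Definition _ := GRing.Zmodule_isLmodule.Build R (restr X)
  restr_scaleA restr_scale1 restr_scaleDr restr_scaleDl.
End RestrScale.

Section ArtinAlgebra.
Hypothesis artA : artin_algebra phi.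

(** The products of generators of A over R with generators of X over A generate
    X over R. *)
Lemma restr_fin_len (X : lmodType A) : fin_gen X ->
  fin_len [set 0] (setT : set (restr X)).
Proof.
move=> [n [g gP]]; case: artA => artR _ [m [h hP]].
pose s : seq (restr X) := [seq h i *: g j | i <- enum 'I_m, j <- enum 'I_n].
apply: (@lspan_full_fin_len _ _ s) (artinian_fin_len artR) => x.
have sS := span_submodule s.
have [c ->] := gP x; apply: (sub_sum sS) => j.
have [d ->] := hP (c j); rewrite scaler_suml; apply: (sub_sum sS) => i.
rewrite -scalerA; apply: (subZ sS (d i)); apply: mem_span.
by apply/allpairsP; exists (i, j); rewrite !mem_enum.
Qed.

(** An A-submodule is an R-submodule, so chains over A are chains over R. *)
Lemma fin_gen_fin_len (X : lmodType A) : fin_gen X ->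
  fin_len [set 0] (setT : set X).
Proof.
move=> /restr_fin_len[N hN]; exists N => n cn; apply: hN.
elim: n setT cn => [|n IH] U //= [T [[T0 TP] /IH cT TU U']].
exists T; split=> //; split=> // a x y; exact: TP.
Qed.

End ArtinAlgebra.

Section Hom.
Hypothesis cphi : forall r a, phi r * a = a * phi r.
Variables M N : lmodType A.

(** Hom over A as an R-module; the centrality of phi is an argument of
    the type because scalar multiples of A-linear maps are A-linear only
    thanks to it. *)
Definition homR (_ : forall r a, phi r * a = a * phi r) : Type :=
  {linear M -> N}.
Local Notation hom := (homR cphi).

HB.instance Definition _ := gen_eqMixin hom.
HB.instance Definition _ := gen_choiceMixin hom.

Fact homZ_linear r (f : hom) : linear (fun x =>
  phi r *: (f : {linear M -> N}) x).
Proof. by move=> a x y; rewrite linearP scalerDr !scalerA cphi. Qed.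

Definition homR0 : hom := \0.
Definition homRN (f : hom) : hom := GRing.opp_fun (f : {linear M -> N}).
Definition homRD (f g : hom) : hom :=
  (f : {linear M -> N}) \+ (g : {linear M -> N}).
Definition homRZ r (f : hom) : hom := lin_of (homZ_linear r f).

Fact homRDA : associative homRD.
Proof. by move=> f g h; apply: linP => x /=; rewrite addrA. Qed.
Fact homRDC : commutative homRD.
Proof. by move=> f g; apply: linP => x /=; rewrite addrC. Qed.
Fact homR0D : left_id homR0 homRD.
Proof. by move=> f; apply: linP => x /=; rewrite add0r. Qed.
Fact homRND : left_inverse homR0 homRN homRD.
Proof. by move=> f; apply: linP => x /=; rewrite addNr. Qed.
HB.instance Definition _ :=
  GRing.isZmodule.Build hom homRDA homRDC homR0D homRND.

Fact homRZA a b f : homRZ a (homRZ b f) = homRZ (a * b) f.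
Proof. by apply: linP => x /=; rewrite scalerA rmorphM. Qed.
Fact homRZ1 : left_id 1 homRZ.
Proof. by move=> f; apply: linP => x /=; rewrite rmorph1 scale1r. Qed.
Fact homRZDr : right_distributive homRZ +%R.
Proof. by move=> a f g; apply: linP => x /=; rewrite scalerDr. Qed.
Fact homRZDl f : {morph homRZ^~ f : a b / a + b}.
Proof. by move=> a b; apply: linP => x /=; rewrite rmorphD scalerDl. Qed.
HB.instance Definition _ := GRing.Zmodule_isLmodule.Build R hom
  homRZA homRZ1 homRZDr homRZDl.

Definition hom_fun (f : hom) : {linear M -> N} := f.

Fact hom_ev_linear (x : M) : linear (fun f : hom => (hom_fun f x : restr N)).
Proof. by []. Qed.
Definition hom_ev x : {linear hom -> restr N} := lin_of (hom_ev_linear x).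

(** Filter Hom by the maps that vanish on longer and longer lists of generators
    of M; evaluation embeds each step in N. *)
Lemma hom_fin_len : artin_algebra phi -> fin_gen M -> fin_gen N ->
  fin_len [set 0] (setT : set hom).
Proof.
move=> artA [n [g gP]] /(restr_fin_len artA) flN.
pose K (s : seq M) : set hom := [set f | forall x, x \in s -> hom_fun f x = 0].
have sK s : submodule (K s).
  split=> [|a f h Kf Kh] x xs //=; first by rewrite Kf // Kh // scaler0 addr0.
have flK s : fin_len (K s) (setT : set hom).
  elim: s => [|x s IH].
    by exists 0%N => -[//|m] /= [T [_ /chain_sub KT _ [f _ []]]]; apply: KT.
  have le : K (x :: s) `<=` K s.
    by move=> f Kf y ys; apply: Kf; rewrite in_cons ys orbT.
  apply: (fin_len_cat (T := K s)) => //.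
  apply: (fin_len_inj (f := hom_ev x) (W' := [set 0]) (U' := setT)) => //.
    exact: submodule0.
  by move=> f Kf fx0 y; rewrite in_cons => /orP[/eqP->//|/Kf].
rewrite (_ : [set 0] = K (codom g)) //; apply/seteqP; split=> [_ -> //|f Kf].
apply: linP => x; have [c ->] := gP x; rewrite linear_sum big1 // => i _.
by rewrite linearZ /= [X in _ *: X]Kf ?scaler0 ?codom_f.
Qed.

End Hom.

End Restriction.

(** * Decomposition into indecomposables *)

Section KrullSchmidt.
Variable S : pzRingType.
Implicit Types X Y Z U V G : lmodType S.

Definition finite_length X := fin_len [set 0] (setT : set X).

Lemma retract_finite_length Y Z : retract Y Z -> finite_length Z ->
  finite_length Y.
Proof.
move=> [s [p ps]]; apply: (fin_len_inj (f := s)) => //; first exact: submodule0.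
by move=> x _ sx0; rewrite /= -(ps x) sx0 linear0.
Qed.

Lemma acc_stationary Y (c : nat -> set Y) : finite_length Y ->
  (forall n, submodule (c n)) -> (forall n, c n `<=` c n.+1) ->
  exists n, c n.+1 `<=` c n.
Proof.
move=> [N hN] sc inc; apply: contrapT => /forallNP nst.
have h n : chain [set 0] n (c n).
  elim: n => [|n IH] /=; first by move=> _ ->; apply: sub0.
  exists (c n); split=> //; have /existsNP[x /not_implyP[cx ncx]] := nst n.
  by exists x.
by have /(chain_mono (@subsetT _ _))/hN := h N.+1; rewrite ltnn.
Qed.

Lemma dcc_stationary Y (c : nat -> set Y) : finite_length Y ->
  (forall n, submodule (c n)) -> (forall n, c n.+1 `<=` c n) ->
  exists n, c n `<=` c n.+1.
Proof.
move=> [N hN] sc inc; apply: contrapT => /forallNP nst.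
have h n k : chain [set 0] n (c k).
  elim: n k => [|n IH] k /=; first by move=> _ ->; apply: sub0.
  exists (c k.+1); split=> //; have /existsNP[x /not_implyP[cx ncx]] := nst k.
  by exists x.
by have /(chain_mono (@subsetT _ _))/hN := h N.+1 0%N; rewrite ltnn.
Qed.

Fixpoint lin_iter Y (f : {linear Y -> Y}) n : {linear Y -> Y} :=
  if n is m.+1 then f \o lin_iter f m else idfun.

Lemma lin_iterE Y (f : {linear Y -> Y}) n x : lin_iter f n x = iter n f x.
Proof. by elim: n => //= n ->. Qed.

(** For t large, Y is the direct sum of the kernel and the image of the t-th
    iterate of f, and one of them is zero as Y is indecomposable. *)
Lemma fitting Y (f : {linear Y -> Y}) : finite_length Y -> indecomposable Y ->
  (exists g : {linear Y -> Y}, forall x, g (f x) = x) \/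
  (exists n, forall x, iter n f x = 0).
Proof.
move=> flY [_ indY].
have [||n kn] := acc_stationary (c := fun n =>
  [set x | lin_iter f n x = 0]) flY.
- by move=> n; apply: ker_submodule.
- by move=> n x /= ->; rewrite linear0.
have [||m im] := dcc_stationary (c := fun n =>
  [set y | exists x, lin_iter f n x = y]) flY.
- by move=> k; apply: range_submodule.
- by move=> k _ [x <-]; exists (f x); rewrite !lin_iterE -iterSr.
have kn' k x : iter (k + n) f x = 0 -> iter n f x = 0.
  elim: k x => [//|k IH] x; rewrite addSn iterSr => /IH fx; move: (kn x).
  by rewrite /= -!lin_iterE; apply; move: fx; rewrite -iterSr -lin_iterE.
have im' k x : exists y, iter m f x = iter (k + m) f y.
  elim: k => [|k [y ->]]; first by exists x.
  have [|z zy] := im (iter m f y); first by exists y; rewrite lin_iterE.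
  by exists z; rewrite iterD -zy lin_iterE -iterD addnS addSn.
have [t [nt mt tp]] : exists t, [/\ (n <= t)%N, (m <= t)%N & (0 < t)%N].
  by exists (maxn n m).+1; split=> //; rewrite leqW ?leq_maxl ?leq_maxr.
have kt x : iter t f (iter t f x) = 0 -> iter t f x = 0.
  rewrite -iterD => h; rewrite -(subnK nt) iterD (kn' (t + t - n)%N x).
    by rewrite -lin_iterE linear0.
  by rewrite subnK // (leq_trans nt) // leq_addr.
have it x : exists y, iter t f x = iter t f (iter t f y).
  have [y yE] := im' t x; exists y.
  rewrite -iterD -{1}(subnK mt) iterD yE -iterD.
  by congr (iter _ f y); rewrite addnCA subnK.
pose K := [set x | lin_iter f t x = 0].
pose I := [set y | exists x, lin_iter f t x = y].
have sK : submodule K := ker_submodule _.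
have sI : submodule I := range_submodule _.
have : isomorphic Y (submod sK * submod sI)%type.
  apply: isom_sym.
  pose h := (submod_lin sK \o fst_lin _ _) \+ (submod_lin sI \o snd_lin _ _).
  apply: (@isom_of_bij _ _ _ h) => [[k i] /= ki0|x].
    have i0 : submod_val i = 0.
      have [y iE] := submod_in i; rewrite -iE lin_iterE; apply: kt.
      rewrite -!lin_iterE iE; have := congr1 (lin_iter f t) ki0.
      by rewrite linearD linear0 [lin_iter f t _](submod_in k) add0r.
    have k0 : submod_val k = 0 by move: ki0; rewrite i0 addr0.
    by congr pair; apply: submod_inj.
  have [y xy] := it x.
  have Kx : K (x - iter t f y).
    by rewrite /K /= linearB !lin_iterE xy subrr.
  have Iy : I (iter t f y) by exists y; rewrite lin_iterE.
  exists (to_submod sK Kx, to_submod sI Iy) => /=; exact: subrK.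
move=> /indY[K0|I0]; [left|right].
  have K0E x : K x -> x = 0.
    by move=> Kx; exact: (congr1 (@submod_val _ _ _) (K0 (to_submod sK Kx))).
  apply: (factor_surj (p := f) (f := idfun)) => [y|x fx0].
    have [z yz] := it y; exists (iter t.-1 f z).
    rewrite -iterS prednK //; apply/eqP; rewrite eq_sym -subr_eq0;
      apply/eqP/K0E.
    by rewrite /K /= linearB !lin_iterE yz subrr.
  by apply: K0E; rewrite /K /= lin_iterE -(prednK tp) iterSr fx0 -lin_iterE linear0.
exists t => x; have Ix : I (iter t f x) by exists x; rewrite lin_iterE.
exact: (congr1 (@submod_val _ _ _) (I0 (to_submod sI Ix))).
Qed.

(** The endomorphism ring of an indecomposable module of finite length is
    local. If both summands were nilpotent, the second would also be injective:
    on its kernel the first is the identity. *)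
Lemma local_sum Y (e1 e2 : {linear Y -> Y}) : finite_length Y ->
  indecomposable Y ->
  (forall x, e1 x + e2 x = x) ->
  exists g : {linear Y -> Y}, (forall x, g (e1 x) = x) \/
    (forall x, g (e2 x) = x).
Proof.
move=> flY indY e12.
have [[g gE]|[n nil1]] := fitting e1 flY indY; first by exists g; left.
have [[g gE]|[m nil2]] := fitting e2 flY indY; first by exists g; right.
have inj x : e2 x = 0 -> x = 0.
  move=> e20; rewrite -(nil1 x);
    have e1x : e1 x = x by rewrite -{2}[x]e12 e20 addr0.
  by elim: n {nil1} => //= n <-.
case: indY => nz _; case: nz => x; move: (nil2 x).
by elim: m {nil2} => //= m IH /inj.
Qed.

Lemma retract_prod Y U V : finite_length Y -> indecomposable Y ->
  retract Y (U * V)%type -> retract Y U \/ retract Y V.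
Proof.
move=> flY indY [s [p ps]].
pose e1 := (p \o inl_lin U V) \o (fst_lin U V \o s).
pose e2 := (p \o inr_lin U V) \o (snd_lin U V \o s).
have [|g [gE|gE]] := @local_sum Y e1 e2 flY indY.
- move=> x /=; rewrite -linearD -{3}(ps x); congr (p _).
  by rewrite [LHS]/(_ + _) /= /add_pair /= addr0 add0r; case: (s x).
- by left; exists (fst_lin U V \o s), (g \o (p \o inl_lin U V)).
- by right; exists (snd_lin U V \o s), (g \o (p \o inr_lin U V)).
Qed.

Definition factors G X := ({linear X -> G} * {linear G -> X})%type.

(** X belongs to add G, in the form used below: the identity of X factors
    through a finite power of G, written as a sum of maps that factor through
    G. *)
Definition id_factors G X := exists l : seq (factors G X),
  forall x, \sum_(u <- l) u.2 (u.1 x) = x.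

Lemma id_factors_retract G X Y : retract Y X -> id_factors G X ->
  id_factors G Y.
Proof.
move=> [s [p ps]] [l lE].
exists [seq ((u.1 \o s : {linear Y -> G}), (p \o u.2 : {linear G -> Y})) | u : factors G X <- l] => x.
by rewrite big_map /= -linear_sum lE ps.
Qed.

Lemma id_factors0 G X : zero_module X -> id_factors G X.
Proof. by move=> X0; exists [::] => x; rewrite big_nil [x]X0. Qed.

Lemma id_factors_prod G X Y Z : isomorphic X (Y * Z)%type ->
  id_factors G Y -> id_factors G Z -> id_factors G X.
Proof.
move=> /isom_retract XYZ [l lE] [k kE]; apply: id_factors_retract XYZ _.
exists ([seq ((u.1 \o fst_lin Y Z : {linear (Y * Z)%type -> G}),
             (inl_lin Y Z \o u.2 : {linear G -> (Y * Z)%type})) | u : factors G Y <- l] ++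
        [seq ((u.1 \o snd_lin Y Z : {linear (Y * Z)%type -> G}),
             (inr_lin Y Z \o u.2 : {linear G -> (Y * Z)%type})) | u : factors G Z <- k]) => -[y z].
rewrite big_cat !big_map; transitivity (inl_lin Y Z y + inr_lin Y Z z).
  by congr (_ + _); [rewrite -{2}(lE y)|rewrite -{2}(kE z)]; rewrite linear_sum.
by rewrite [LHS]/(_ + _) /= /add_pair /= addr0 add0r.
Qed.

Lemma id_factors_trans G X Y : id_factors G X -> id_factors X Y ->
  id_factors G Y.
Proof.
move=> [l lE] [k kE].
exists [seq ((u.1 \o w.1 : {linear Y -> G}), (w.2 \o u.2 : {linear G -> Y})) | u : factors G X <- l, w : factors X Y <- k].
move=> x; rewrite big_allpairs_dep /= exchange_big /= -[RHS]kE.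
by apply: eq_bigr => w _; rewrite -linear_sum lE.
Qed.

Lemma id_factors_self G : id_factors G G.
Proof.
by exists [:: (idfun : {linear G -> G}, idfun : {linear G -> G})] => x;
  rewrite big_seq1.
Qed.

Lemma id_factors_power G n : id_factors G {ffun 'I_n -> G}.
Proof.
have pL (i : 'I_n) : linear (fun x : {ffun 'I_n -> G} => x i).
  by move=> a x y; rewrite !ffunE.
have iL (i : 'I_n) : linear (fun g => [ffun j =>
  if j == i then g else 0] : {ffun 'I_n -> G}).
  move=> a x y; apply/ffunP => j; rewrite !ffunE.
  by case: ifP => //; rewrite scaler0 addr0.
exists [seq (lin_of (pL i), lin_of (iL i)) | i <- enum 'I_n] => x.
rewrite big_map /=; apply/ffunP => j;
  rewrite sum_ffunE big_enum /= (bigD1 j) //=.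
rewrite ffunE eqxx big1 ?addr0 // => i; rewrite ffunE eq_sym => /negPf->//.
Qed.

Lemma in_add_id_factors G X : in_add G X -> id_factors G X.
Proof.
by move=> [n [N h]]; apply: id_factors_retract (retract_fst h) (id_factors_power G n).
Qed.

Lemma id_factors_fin_gen G X : id_factors G X -> fin_gen G -> fin_gen X.
Proof.
move=> [l lE] [n [g gP]].
pose s := [seq u.2 (g i) | u : factors G X <- l, i <- enum 'I_n].
have sS := span_submodule s.
apply: (span_fin_gen (s := s)) => x; rewrite -[x]lE.
suff h u : List.In u l -> lspan s (u.2 (u.1 x)).
  elim: (l) h => [|u l' IH] h; first by rewrite big_nil; apply: sub0.
  rewrite big_cons; apply: subD => //; first by apply: h; left.
  by apply: IH => v lv; apply: h; right.
move=> ul; have [c ->] := gP (u.1 x); rewrite linear_sum; apply: sub_sum =>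
  // i.
rewrite linearZ; apply: (subZ sS (c i)); apply: mem_span.
rewrite /s; elim: (l) ul => //= v l' IH [->|/IH h]; rewrite mem_cat.
  by apply/orP; left; apply/mapP; exists i; rewrite ?mem_enum.
by rewrite h orbT.
Qed.

(** In a local endomorphism ring, a sum of maps factoring through G can be
    invertible only if one of its terms is. *)
Lemma indec_id_factors G Y : finite_length Y -> indecomposable Y ->
  id_factors G Y -> retract Y G.
Proof.
move=> flY indY [l lE].
have : exists g : {linear Y -> Y}, forall x, g (\sum_(u <- l) u.2 (u.1 x)) = x.
  by exists idfun.
elim: l {lE} => [[g gE]|u l IH [g gE]].
  by case: indY => nz _; case: nz => x; rewrite -(gE x) big_nil linear0.
have bL := @comb_linear _ _ l Y Y (fun u => u.2 \o u.1).
have [|h [hE|hE]] := @local_sum Y (g \o (u.2 \o u.1)) (g \o lin_of bL) flY indY.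
- by move=> x; rewrite /= -linearD -[RHS]gE big_cons.
- by exists u.1, (h \o (g \o u.2)).
- by apply: IH; exists (h \o g) => x; have := hE x.
Qed.

(** The list contains the summands of a finite decomposition, obtained by
    splitting modules in two repeatedly. *)
Inductive direct_sum : seq (lmodType S) -> lmodType S -> Prop :=
| DirectSum0 X of zero_module X : direct_sum [::] X
| DirectSum1 X : direct_sum [:: X] X
| DirectSumCat s t X Y Z of isomorphic X (Y * Z)%type &
    direct_sum s Y & direct_sum t Z : direct_sum (s ++ t) X.

Lemma direct_sum_retract s X Y : direct_sum s X -> List.In Y s -> retract Y X.
Proof.
elim=> {s X} [X _ []|X [->|[]]|s t X U V XUV _ IH1 _ IH2 /List.in_app_iff[]].
- by exists idfun, idfun.
- by move=> /IH1 h; apply: retract_trans h (retract_fst XUV).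
- by move=> /IH2 h; apply: retract_trans h (retract_snd XUV).
Qed.

Lemma direct_sum_id_factors G s X : direct_sum s X ->
  (forall Y, List.In Y s -> id_factors G Y) -> id_factors G X.
Proof.
elim=> {s X} [X X0 _|X|s t X Y Z XYZ _ IH1 _ IH2 h]; first exact: id_factors0.
  by apply; left.
by apply: (id_factors_prod XYZ); [apply: IH1|apply: IH2] => U Us; apply: h;
  apply/List.in_app_iff; [left|right].
Qed.

Lemma isom_swap X Y Z : isomorphic X (Y * Z)%type -> isomorphic X (Z * Y)%type.
Proof.
move=> [f [g fK gK]]; exists ((inl_lin Z Y \o (snd_lin Y Z \o f)) \+
   (inr_lin Z Y \o (fst_lin Y Z \o f))).
exists (fun u => g (u.2, u.1)) => [x|[z y]] /=.
  by rewrite addr0 add0r -surjective_pairing fK.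
by rewrite gK /= [LHS]/(_ + _) /= /add_pair /= addr0 add0r.
Qed.

(** A chain in Y can be continued by one step in X, from Y to X itself. *)
Lemma chain_summand X Y Z n : isomorphic X (Y * Z)%type -> ~ zero_module Z ->
  chain [set 0] n (setT : set Y) -> chain [set 0] n.+1 (setT : set X).
Proof.
move=> XYZ /existsNP[z z0] cn.
have [f [g fK gK]] := isom_sym XYZ.
pose i := f \o inl_lin Y Z.
have fi := can_inj fK.
have sr : submodule (range i) by exact: image_submodule.
exists (range i); split=> //.
  apply: (chain_inj (f := i)) cn => //.
  - exact: submodule0.
  - by move=> _ ->; apply: sub0.
  - move=> x _ fx0; have e : i x = f 0 by rewrite linear0; exact: fx0.
    by have /(congr1 fst) := fi _ _ e.
by exists (f (0, z)) => // -[y _ /fi/(congr1 snd)/esym].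
Qed.

(** Splitting a module into two nonzero summands lowers the length of both. *)
Lemma indec_decomposition X : finite_length X ->
  exists s, direct_sum s X /\ forall Y, List.In Y s -> indecomposable Y.
Proof.
move=> [N]; elim: N X => [|N IH] X hN;
  have [X0|nX0] := pselect (zero_module X); try by exists [::]; split=> //;
    constructor.
- case: nX0 => x; apply: contrapT => x0.
  suff /hN : chain [set 0] 1 (setT : set X) by [].
  by exists [set 0]; split=> //; [exact: submodule0|exists x].
have [indX|nindX] := pselect (indecomposable X).
  by exists [:: X]; split=> [|Y [<-|[]] //]; constructor.
have [U [V [XUV nU nV]]] : exists U V, [/\ isomorphic X (U * V)%type,
    ~ zero_module U & ~ zero_module V].
  apply: contrapT => no; apply: nindX; split=> // U V XUV; apply: contrapT.
  by move=> /not_orP[nU nV]; apply: no; exists U, V.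
have [n /(chain_summand XUV nV)/hN //|s [sU is_]] := IH U.
have [n /(chain_summand (isom_swap XUV) nU)/hN //|t [tV it]] := IH V.
exists (s ++ t); split; first exact: DirectSumCat XUV sU tV.
by move=> Y /List.in_app_iff[/is_|/it].
Qed.

Lemma retract_indec Y Z : ~ zero_module Y -> indecomposable Z ->
  retract Y Z -> isomorphic Y Z.
Proof.
move=> nY [_ indZ] [s [p ps]]; have [//|k0] := indZ _ _ (retract_split ps).
apply: (isom_of_bij (f := s)) => [x sx0|z];
  first by rewrite -(ps x) sx0 linear0.
exists (p z); apply/eqP; rewrite eq_sym -subr_eq0; apply/eqP.
have kz : p (z - s (p z)) = 0 by rewrite linearB ps subrr.
exact: (congr1 (@submod_val _ _ _) (k0 (to_submod (ker_submodule p) kz))).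
Qed.

(** The half of the Krull-Schmidt theorem that is used: the indecomposable
    summands of G are, up to isomorphism, those of any given decomposition. *)
Lemma exchange s G Y : direct_sum s G -> (forall Z, List.In Z s ->
  indecomposable Z) ->
  finite_length Y -> indecomposable Y -> retract Y G ->
  exists2 Z, List.In Z s & isomorphic Y Z.
Proof.
move=> + + flY indY; elim=> {s G} [X X0 _ [s [p ps]]|X iX rX|s t X U V XUV _ IH1 _ IH2 iX rX].
- by case: indY => nz _; case: nz => x; rewrite -(ps x) [s x]X0 linear0.
- by exists X; [left|apply: retract_indec => //; [case: indY|apply: iX; left]].
have [/IH1[|Z]|/IH2[|Z]] :=
  retract_prod flY indY (retract_trans rX (isom_retract XUV)).
- by move=> Z Zs; apply: iX; apply/List.in_app_iff; left.
- by exists Z => //; apply/List.in_app_iff; left.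
- by move=> Z Zs; apply: iX; apply/List.in_app_iff; right.
- by exists Z => //; apply/List.in_app_iff; right.
Qed.

(** Functions that factor through the split Grothendieck group. *)
Definition additive_fun (v : lmodType S -> nat) :=
  (forall X, zero_module X -> v X = 0%N) /\
  forall X Y Z, fin_gen X -> isomorphic X (Y * Z)%type -> v X = (v Y + v Z)%N.

Lemma additive_isom v X Y : additive_fun v -> fin_gen X -> isomorphic X Y ->
  v X = v Y.
Proof.
move=> [v0 vD] fX [f [g fK gK]].
pose T := submod (@submodule0 _ X : submodule ([set 0] : set X)).
have T0 : zero_module T by case=> x x0; apply: submod_inj.
rewrite (vD X Y T fX) ?(v0 _ T0) ?addn0 //; exists (inl_lin Y T \o f).
exists (fun u => g u.1) => [x|[y t]] /=; first by rewrite fK.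
by rewrite gK [t]T0.
Qed.

Lemma direct_sum_additive v s X : additive_fun v -> direct_sum s X ->
  fin_gen X ->
  v X = (\sum_(Y <- s) v Y)%N.
Proof.
move=> [v0 vD]; elim=> {s X} [X X0 _|X _|s t X U V XUV _ IH1 _ IH2 fX].
- by rewrite big_nil v0.
- by rewrite big_seq1.
rewrite (vD _ _ _ fX XUV) big_cat /= IH1 ?IH2 //.
  exact: retract_fin_gen (retract_snd XUV) fX.
exact: retract_fin_gen (retract_fst XUV) fX.
Qed.

(** The split Grothendieck group of add G has finite rank: the Gs are the
    indecomposable summands of G, and a counts their multiplicities in X. The
    same a serves all additive functions. *)
Theorem add_finite_rank G : finite_length G ->
  exists r (Gs : 'I_r -> lmodType S), forall X, fin_gen X -> finite_length X ->
    id_factors G X -> exists a : 'I_r -> nat, forall v, additive_fun v ->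
      v X = (\sum_j a j * v (Gs j))%N.
Proof.
move=> /indec_decomposition[s [sG inds]].
exists (size s), (fun j => nth G s j) => X fX flX addX.
have [t [tX indt]] := indec_decomposition flX.
have ts Y : List.In Y t -> fin_gen Y /\ exists2 Z, List.In Z s & isomorphic Y Z.
  move=> Yt; have rY := direct_sum_retract tX Yt.
  split; first exact: retract_fin_gen rY fX.
  have flY := retract_finite_length rY flX.
  apply: (exchange sG inds flY (indt _ Yt)).
  exact: indec_id_factors flY (indt _ Yt) (id_factors_retract rY addX).
suff [a aE] : exists a : 'I_(size s) -> nat, forall v, additive_fun v ->
    (\sum_(Y <- t) v Y = \sum_j a j * v (nth G s j))%N.
  by exists a => v av; rewrite -aE //; apply: direct_sum_additive.
elim: t ts {tX indt} => [_|Y t IH ts].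
  by exists (fun=> 0%N) => v _; rewrite big_nil big1 // => j; rewrite mul0n.
have [|a aE] := IH; first by move=> Z Zt; apply: ts; right.
have [fY [Z /(List.In_nth _ _ G)[n [/ssrnat.ltP ns nZ]] YZ]] :=
  ts Y (or_introl erefl).
exists (fun j => (j == Ordinal ns) + a j)%N => v av.
rewrite big_cons aE // (additive_isom av fY YZ) -nZ.
under [RHS]eq_bigr do rewrite mulnDl.
rewrite big_split /=; congr (_ + _)%N.
rewrite (bigD1 (Ordinal ns)) //= eqxx mul1n big1 => [|j /negPf-> //].
rewrite addn0; congr v.
by elim: (s) n {ns nZ} => [|W s' IHs] [|n] //=.
Qed.

End KrullSchmidt.

(** * Projective resolutions and syzygies *)

Section ProjectiveDimension.
Variable S : pzRingType.
Implicit Types X Y K P Q T : lmodType S.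

Definition fgproj P := fin_gen P /\ projective P.

Lemma regular_lin X (f : {linear S^o -> X}) (c : S) : f c = c *: f 1.
Proof. by rewrite -linearZ; congr (f _); rewrite [RHS]mulr1. Qed.

(** The dual basis lemma. *)
Lemma fgproj_id_factors P : fgproj P <-> id_factors (S^o) P.
Proof.
split=> [[[n [g gP]] pP]|[l lE]].
  have cL : linear (fun c : {ffun 'I_n -> S^o} => \sum_i (c i : S) *: g i).
    move=> a c d; rewrite scaler_sumr -big_split; apply: eq_bigr => i _.
    by rewrite !ffunE scalerDl scalerA.
  have [x|h hE] := pP _ _ (lin_of cL) idfun.
    have [c cE] := gP x; exists [ffun i => c i] => /=; rewrite [RHS]cE.
    by apply: eq_bigr => i _; rewrite ffunE.
  have eL (i : 'I_n) : linear (fun c : {ffun 'I_n -> S^o} => c i).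
    by move=> a c d; rewrite !ffunE.
  exists [seq ((lin_of (eL i) \o h : {linear P -> S^o}), scale_lin (g i)) | i <- enum 'I_n].
  by move=> x; rewrite big_map big_enum /=; apply: hE.
split.
  exists (size l), (fun i => (tnth (in_tuple l) i).2 1) => x.
  exists (fun i => (tnth (in_tuple l) i).1 x).
  rewrite -[LHS]lE big_tnth; apply: eq_bigr => i _.
  exact: regular_lin.
move=> X Y p f ps; have /choice[y yE] := fun u : factors S^o P =>
  ps (f (u.2 1)).
have hL := comb_linear l (fun u : factors S^o P => scale_lin (y u) \o u.1).
exists (lin_of hL) => x /=; rewrite linear_sum -[in RHS](lE x) linear_sum.
by apply: eq_bigr => u _; rewrite linearZ yE -linearZ -regular_lin.
Qed.

Definition ses K Q X (i : {linear K -> Q}) (p : {linear Q -> X}) :=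
  [/\ injective i, forall y, exists x, p x = y &
      forall x, p x = 0 <-> exists y, i y = x].

(** X has a resolution of length at most n by finitely generated projective
    modules. Any module isomorphic to the kernel of p may serve as K, so that
    syzygies need not be transported along isomorphisms. *)
Fixpoint fpd n X : Prop :=
  if n is m.+1 then
    exists Q K (i : {linear K -> Q}) (p : {linear Q -> X}),
      [/\ fgproj Q, ses i p & fpd m K]
  else fgproj X.

Lemma fgproj_retract P Q : retract P Q -> fgproj Q -> fgproj P.
Proof.
by move=> r [fQ pQ]; split;
  [apply: retract_fin_gen r fQ|apply: retract_projective r pQ].
Qed.

Lemma isom_refl X : isomorphic X X.
Proof. by exists idfun; exists idfun. Qed.

Lemma fgproj_prod P Q : fgproj P -> fgproj Q -> fgproj (P * Q)%type.
Proof.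
by move=> /fgproj_id_factors aP /fgproj_id_factors aQ;
  apply/fgproj_id_factors/(id_factors_prod (isom_refl _) aP aQ).
Qed.

Lemma fpd_isom n X Y : isomorphic X Y -> fpd n X -> fpd n Y.
Proof.
case: n => [|n] XY /=;
  first exact: (fgproj_retract (isom_retract (isom_sym XY))).
move: XY => [f [g fK gK]] [Q [K [i [p [fQ [inj surj ex] fK']]]]].
exists Q, K, i, (f \o p); split=> //; split=> // [y|x].
  by have [x xE] := surj (g y); exists x; rewrite /= xE gK.
rewrite -ex /=; split=> [fp0|->]; last exact: linear0.
by apply: (can_inj fK); rewrite fp0 linear0.
Qed.

Lemma fpd_prod n X P : fpd n X -> fgproj P -> fpd n (X * P)%type.
Proof.
case: n => [|n] /=; first exact: fgproj_prod.
move=> [Q [K [i [p [fQ [inj surj ex] fK]]]]] fP.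
have qL : linear (fun u : (Q * P)%type => (p u.1, u.2)).
  by move=> a x y; congr pair; rewrite /= linearP.
exists (Q * P)%type, K, (inl_lin Q P \o i), (lin_of qL).
split=> //; first exact: fgproj_prod.
split=> [x y /(congr1 fst) /inj //|[y b]|[x b]] /=.
  by have [x <-] := surj y; exists (x, b).
split=> [[/ex[y <-] ->]|[y [<- <-]]]; first by exists y.
by congr pair; apply/ex; exists y.
Qed.

Lemma schanuel K P X K' Q (i : {linear K -> P}) (p : {linear P -> X})
    (j : {linear K' -> Q}) (q : {linear Q -> X}) :
  ses i p -> ses j q -> projective P -> projective Q ->
  isomorphic (K * Q)%type (K' * P)%type.
Proof.
move=> [ii ps pe] [ji qs qe] pP pQ.
have [t tE] : exists t : {linear Q -> P}, forall x, p (t x) = q x.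
  by apply: proj_lift => // x; apply: ps.
have [u uE] : exists u : {linear P -> Q}, forall x, q (u x) = p x.
  by apply: proj_lift => // x; apply: qs.
(* Both sides are the pullback of p and q: (k, b) is sent to the pair
   (i k + t b, b) of the pullback, which is (a, j k' + u a) for a unique k'. *)
have pi k : p (i k) = 0 by apply/pe; exists k.
have qj k : q (j k) = 0 by apply/qe; exists k.
pose a : {linear (K * Q)%type -> P} := (i \o fst_lin K Q) \+ (t \o snd_lin K Q).
pose b : {linear (K * Q)%type -> Q} := snd_lin K Q \- (u \o a).
have [|c cE] := @factor_inj _ _ _ _ j b ji.
  move=> x; apply/qe; rewrite /= linearB uE linearD pi add0r tE; exact: subrr.
have fL : linear (fun x => (c x, a x)).
  by move=> r x y; congr pair; rewrite linearP.
apply: (isom_of_bij (f := lin_of fL)) => [x /= [c0 a0]|[k' y]].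
  have b0 : x.2 = 0.
    by have := cE x; rewrite c0 linear0 /= a0 linear0 subr0 => ->.
  case: x b0 c0 a0 => [k x2] /= -> _; rewrite linear0 addr0 => ik0.
  by congr pair; apply: ii; rewrite ik0 linear0.
pose z := j k' + u y.
have [k kE] : exists k, i k = y - t z.
  by apply/pe; rewrite linearB tE linearD qj add0r uE subrr.
have az : a (k, z) = y by rewrite /= kE subrK.
exists (k, z) => /=; congr pair => //.
have bE : b (k, z) = z - u (a (k, z)) by [].
by apply: ji; rewrite cE bE az addrK.
Qed.

(** With Q -> X * P a first step for X * P, the composite Q -> X is a first
    step for X; its kernel is an extension of P by K, which splits. *)
Lemma fpd_cancel n X P : fpd n (X * P)%type -> fgproj P -> fpd n X.
Proof.
case: n => [|n] /=.
  by move=> h _; apply: fgproj_retract h; exists (inl_lin X P), (fst_lin X P).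
move=> [Q [K [i [p [fQ [inj surj ex] fK]]]]] fP.
pose q := fst_lin X P \o p; pose sT := ker_submodule q.
exists Q, (submod sT), (submod_lin sT), q; split=> //.
  split=> [x y /submod_inj //|y|x].
    by have [x xE] := surj (y, 0); exists x; rewrite /= xE.
  by split=> [qx|[y <-]]; [exists (to_submod sT qx)|exact: (submod_in y)].
have [|s sE] := proj_lift (p := p) (f := inr_lin X P) fP.2; first by move=> x;
  apply: surj.
have [|s' s'E] := submod_corestrict sT (f := s).
  by move=> x; rewrite /= sE.
have pi k : p (i k) = 0 by apply/ex; exists k.
have [|i' i'E] := submod_corestrict sT (f := i); first by move=> x;
  rewrite /= pi.
apply: fpd_isom (fpd_prod fK fP).
pose h := (i' \o fst_lin K P) \+ (s' \o snd_lin K P).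
have hE k y : submod_val (h (k, y)) = i k + s y by rewrite /= i'E s'E.
apply: (isom_of_bij (f := h)) => [[k y] h0|t].
  have e : i k + s y = 0 :=
    etrans (esym (hE k y)) (congr1 (@submod_val _ _ _) h0).
  have y0 : y = 0.
    by have := congr1 p e; rewrite linearD pi sE linear0 add0r => /(congr1 snd).
  by move: e; rewrite y0 linear0 addr0 => ik0; congr pair; apply: inj;
    rewrite ik0 linear0.
pose y := (p (submod_val t)).2.
have [k kE] : exists k, i k = submod_val t - s y.
  apply/ex; rewrite linearB sE; have := submod_in t; rewrite /y /=.
  by case: (p _) => /= ? ? ->; rewrite subrr.
by exists (k, y); apply: submod_inj; rewrite hE kE subrK.
Qed.

(** Schanuel's lemma compares K with the kernel of the first step of the given
    resolution of X. *)
Lemma fpd_syzygy n X P K (i : {linear K -> P}) (p : {linear P -> X}) :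
  fpd n.+1 X -> ses i p -> fgproj P -> fpd n K.
Proof.
move=> [Q [K' [j [q [fQ sq fK']]]]] sp fP.
apply: (fpd_cancel _ fQ); apply: (fpd_isom _ (fpd_prod fK' fP)).
exact: schanuel sq sp fQ.2 fP.2.
Qed.

Section Resolution.
Variables (M : lmodType S) (P : proj_resolution M).

(** The kernel of the map that leaves P n, the augmentation being the one that
    leaves P 0. *)
Definition cycle n : set (P n) :=
  match n return set (P n) with
  | 0 => [set x | res_aug P x = 0]
  | m.+1 => [set x | res_diff P m x = 0]
  end.

Lemma cycle_submodule n : submodule (@cycle n).
Proof. by case: n => [|n]; apply: ker_submodule. Qed.

Lemma cycleP n x : @cycle n x <-> exists y, res_diff P n y = x.
Proof. by case: n x => [|n] x; [apply: res_exact0|apply: res_exact]. Qed.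

(** With this numbering [syz n] is the (n + 1)-st syzygy of M. *)
Definition syz n : lmodType S := submod (@cycle_submodule n).

Definition syz_in n : {linear syz n -> P n} := submod_lin (@cycle_submodule n).

Lemma diff_cycle n x : @cycle n (res_diff P n x).
Proof. by apply/cycleP; exists x. Qed.

Lemma diffK n x : res_diff P n (res_diff P n.+1 x) = 0.
Proof. exact: (diff_cycle (n := n.+1)). Qed.

Fact syz_pi_linear n : linear (fun x =>
  to_submod (@cycle_submodule n) (diff_cycle x)).
Proof. by move=> a x y; apply: submod_inj; rewrite /= linearP. Qed.

Definition syz_pi n : {linear P n.+1 -> syz n} := lin_of (@syz_pi_linear n).

Lemma syz_piE n x : syz_in n (syz_pi n x) = res_diff P n x.
Proof. by []. Qed.

Lemma syz_pi_surj n y : exists x, syz_pi n x = y.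
Proof.
have [x xE] := (cycleP _).1 (submod_in y); exists x; exact: submod_inj.
Qed.

Lemma syz_pi_eq0 n x : syz_pi n x = 0 <-> res_diff P n x = 0.
Proof. by split=> [h|h]; [rewrite -syz_piE h|apply: submod_inj]. Qed.

Lemma syz_ses n : ses (syz_in n.+1) (syz_pi n).
Proof.
split=> [x y /submod_inj //|y|x]; first exact: syz_pi_surj.
rewrite syz_pi_eq0; split=> [h|[y <-]]; last exact: (submod_in y).
by exists (to_submod (@cycle_submodule n.+1) h).
Qed.

Lemma syz_ses0 : ses (syz_in 0) (res_aug P).
Proof.
split=> [x y /submod_inj //|y|x]; first exact: res_aug_surj.
split=> [h|[y <-]]; last exact: (submod_in y).
by exists (to_submod (@cycle_submodule 0) h).
Qed.

Lemma res_fgproj n : fgproj (P n).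
Proof. by split; [apply: res_fin_gen|apply: res_projective]. Qed.

Lemma syz_fin_gen n : fin_gen (syz n).
Proof. exact: surj_fin_gen (@syz_pi_surj n) (res_fin_gen P n.+1). Qed.

Lemma res_fpd n : (forall i, (n.+1 < i)%N -> zero_module (P i)) -> fpd n.+1 M.
Proof.
move=> zP; exists (P 0%N), (syz 0), (syz_in 0), (res_aug P).
split; [exact: res_fgproj|exact: syz_ses0|].
suff gen m k : (forall i, (m + k.+1 < i)%N -> zero_module (P i)) ->
  fpd m (syz k).
  by apply: gen => i; rewrite addn1; apply: zP.
elim: m k => [|m IH] k zPk /=.
  apply: fgproj_retract (res_fgproj k.+1); apply/isom_retract/isom_sym.
  apply: (isom_of_bij (f := syz_pi k)) => [x /syz_pi_eq0 dx|];
    last exact: syz_pi_surj.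
  have [y <-] := (@cycleP k.+1 x).1 dx.
  by rewrite (zPk k.+2 _ y) ?linear0 // add0n.
exists (P k.+1), (syz k.+1), (syz_in k.+1), (syz_pi k).
split; [exact: res_fgproj|exact: syz_ses|].
by apply: IH => i; rewrite addnS -addSn; apply: zPk.
Qed.

End Resolution.

Section Comparison.
Variable M : lmodType S.
(** The n-th component of a chain map over the identity of M. Only the
    components up to n are asserted to exist, which avoids the choice of a full
    chain map. *)
Fixpoint lifts_id (P' Q' : proj_resolution M) n : {linear P' n -> Q' n} ->
  Prop :=
  match n with
  | 0 => fun a => forall x, res_aug Q' (a x) = res_aug P' x
  | m.+1 => fun a => exists2 b, @lifts_id P' Q' m b &
      forall x, res_diff Q' m (a x) = b (res_diff P' m x)
  end.

Lemma lifts_step (P' Q' : proj_resolution M) n (b : {linear P' n -> Q' n}) : lifts_id b ->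
  exists a : {linear P' n.+1 -> Q' n.+1},
    forall x, res_diff Q' n (a x) = b (res_diff P' n x).
Proof.
move=> lb; apply: (proj_lift (f := b \o res_diff P' n));
  first exact: res_projective.
move=> x; apply/cycleP; case: n b lb x => [|n] b /= lb x.
  by rewrite lb; exact: (@diff_cycle _ P' 0).
by case: lb => b' _ ->; rewrite diffK linear0.
Qed.

Lemma lifts_ex (P' Q' : proj_resolution M) n : exists a : {linear P' n -> Q' n}, lifts_id a.
Proof.
elim: n => [|n [b lb]].
  apply: (proj_lift (f := res_aug P')); first exact: res_projective.
  by move=> x; apply: res_aug_surj.
by have [a aE] := lifts_step lb; exists a; exists b.
Qed.

Lemma lifts_comp (P' Q' : proj_resolution M) n (a : {linear P' n -> Q' n}) (b : {linear Q' n -> P' n}) :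
  lifts_id a -> lifts_id b -> @lifts_id P' P' n (b \o a).
Proof.
elim: n a b => [|n IH] a b /= la lb; first by move=> x; rewrite lb la.
case: la lb => a' la' aE [b' lb' bE]; exists (b' \o a'); first exact: IH.
by move=> x /=; rewrite bE aE.
Qed.

(** Two chain maps over the identity of M are homotopic; here one of them is
    the identity. *)
Lemma lifts_homotopic (P' : proj_resolution M) n (a : {linear P' n.+1 -> P' n.+1}) : lifts_id a ->
  exists (h : {linear P' n.+1 -> P' n.+2}) (k : {linear P' n -> P' n.+1}),
    forall x, a x - x = res_diff P' n.+1 (h x) + k (res_diff P' n x).
Proof.
have step m (b : {linear P' m -> P' m}) (a' : {linear P' m.+1 -> P' m.+1})
    (h : {linear P' m -> P' m.+1}) :
    (forall x, res_diff P' m (a' x) = b (res_diff P' m x)) ->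
    (forall x, b (res_diff P' m x) - res_diff P' m x = res_diff P' m (h (res_diff P' m x))) ->
    exists (h' : {linear P' m.+1 -> P' m.+2}) (k : {linear P' m -> P' m.+1}),
      forall x, a' x - x = res_diff P' m.+1 (h' x) + k (res_diff P' m x).
  move=> aE bE; pose f := (a' \- idfun) \- (h \o res_diff P' m).
  have [|x|h' hE] := proj_lift (p := res_diff P' m.+1) (f := f).
  - exact: res_projective.
  - by apply/res_exact; rewrite /= !linearB /= aE bE subrr.
  by exists h', h => x; rewrite hE /= subrK.
elim: n a => [|n IH] a [b lb aE].
  have [|x|h hE] := proj_lift (p := res_diff P' 0) (f := b \- idfun).
  - exact: res_projective.
  - by apply/res_exact0; rewrite linearB /= lb subrr.
  by apply: (step _ b a h) => // x; rewrite hE.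
have [h [k hk]] := IH b lb.
apply: (step _ b a h) => // x.
by rewrite hk diffK linear0 addr0.
Qed.

(** Comparison of resolutions: the vanishing of Ext can be tested on any
    resolution. Transport f to the other resolution and back; the homotopy
    accounts for the difference with f, up to a coboundary. *)
Lemma ext_vanishes_res j (N : lmodType S) (P' : proj_resolution M) :
  ext_vanishes j.+1 M N ->
  forall f : {linear P' j.+1 -> N}, ext_cocycle f -> ext_coboundary f.
Proof.
move=> [Q' vQ] f cf.
have [a la] := lifts_ex P' Q' j.+1; have [b lb] := lifts_ex Q' P' j.+1.
have [b' b'E] := lifts_step lb.
have [h [k hk]] := lifts_homotopic (lifts_comp la lb).
have [|g gE] := vQ (f \o b) _.
  by move=> x; rewrite /= -b'E; apply: cf.
have [a' _ aE] := la.
exists ((g \o a') \- (f \o k)) => x /=.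
rewrite -aE -gE /=; have -> : f x = f (b (a x)) - f (b (a x) - x).
  by rewrite linearB subKr.
by have /= -> := hk x; rewrite linearD [f (res_diff _ _ _)]cf add0r.
Qed.

End Comparison.
End ProjectiveDimension.

(** * The functor Hom(G, -) *)

Section HomFunctor.
Variables (A : pzRingType) (G : lmodType A).
Local Notation E := ((endo G)^c).
Implicit Types X Y Z K L : lmodType A.

(** Hom(G, X) as a left module over the opposite of End(G), which acts by
    composition on the right. *)
Definition homG X : Type := {linear G -> X}.

Section HomModule.
Variable X : lmodType A.
Local Notation hom := (homG X).

HB.instance Definition _ := gen_eqMixin hom.
HB.instance Definition _ := gen_choiceMixin hom.

Definition homG0 : hom := \0.
Definition homGN (f : hom) : hom := GRing.opp_fun (f : {linear G -> X}).
Definition homGD (f g : hom) : hom :=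
  (f : {linear G -> X}) \+ (g : {linear G -> X}).
Definition homGZ (e : E) (f : hom) : hom :=
  (f : {linear G -> X}) \o (e : {linear G -> G}).

Fact homGDA : associative homGD.
Proof. by move=> f g h; apply: linP => x /=; rewrite addrA. Qed.
Fact homGDC : commutative homGD.
Proof. by move=> f g; apply: linP => x /=; rewrite addrC. Qed.
Fact homG0D : left_id homG0 homGD.
Proof. by move=> f; apply: linP => x /=; rewrite add0r. Qed.
Fact homGND : left_inverse homG0 homGN homGD.
Proof. by move=> f; apply: linP => x /=; rewrite addNr. Qed.
HB.instance Definition _ :=
  GRing.isZmodule.Build hom homGDA homGDC homG0D homGND.

Fact homGZA a b f : homGZ a (homGZ b f) = homGZ (a * b) f.
Proof. exact: linP. Qed.
Fact homGZ1 : left_id 1 homGZ.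
Proof. by move=> f; apply: linP. Qed.
Fact homGZDr : right_distributive homGZ +%R.
Proof. by move=> a f g; apply: linP. Qed.
Fact homGZDl f : {morph homGZ^~ f : a b / a + b}.
Proof. by move=> a b; apply: linP => x; exact: linearD. Qed.
HB.instance Definition _ := GRing.Zmodule_isLmodule.Build E hom
  homGZA homGZ1 homGZDr homGZDl.

Definition homG_fun (f : hom) : {linear G -> X} := f.

Lemma homG_sum (I : Type) (r : seq I) (F : I -> hom) x :
  homG_fun (\sum_(i <- r) F i) x = \sum_(i <- r) homG_fun (F i) x.
Proof. by elim/big_rec2: _ => // i y1 y2 _ <-. Qed.

End HomModule.

Fact homG_map_linear X Y (f : {linear X -> Y}) :
  linear (fun h : homG X => (f \o homG_fun h : homG Y)).
Proof. by move=> e g h; apply: linP => x; exact: linearD. Qed.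
Definition homG_map X Y (f : {linear X -> Y}) : {linear homG X -> homG Y} :=
  lin_of (homG_map_linear f).

Fact homG_out_linear : linear (fun h : homG G => (h : E^o)).
Proof. by []. Qed.
Fact homG_in_linear : linear (fun h : E^o => (h : homG G)).
Proof. by []. Qed.

(** The functor Hom(G, -) sends G to the regular module, hence add G to
    finitely generated projective modules. *)
Lemma homG_fgproj X : id_factors G X -> fgproj (homG X).
Proof.
move=> [l lE]; apply/fgproj_id_factors.
exists [seq ((lin_of homG_out_linear \o homG_map u.1 : {linear homG X -> E^o}),
             (homG_map u.2 \o lin_of homG_in_linear : {linear E^o -> homG X}))
       | u : factors G X <- l].
move=> h; rewrite big_map /=; apply: linP => x.
by rewrite -[RHS]lE; exact: homG_sum.
Qed.

Hypothesis genG : id_factors G A^o.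

(** Write 1 as a sum of values of maps from G to A, and apply the map from A to
    X that sends 1 to x. *)
Lemma generator_trace X (x : X) : exists (r : seq ({linear G -> X} * G)),
  x = \sum_(u <- r) u.1 u.2.
Proof.
have [l lE] := genG.
exists [seq ((scale_lin x \o u.2 : {linear G -> X}), u.1 1) | u : factors G A^o <- l].
by rewrite big_map /= -scaler_suml lE scale1r.
Qed.

(** For a generator G the functor Hom(G, -) is full on maps from X to G. With 1
    = sum_v b_v(g_v), where b_v maps G to A, every x in X is the sum of the
    values at g_v of the maps g |-> b_v(g) x; an End(G)-linear form h on Hom(G,
    X) therefore comes from t x = sum_v h(g |-> b_v(g) x)(g_v). Thus a dual
    basis of Hom(G, X) is a factorization of the identity of X through G. *)
Lemma homG_fgproj_add X : fgproj (homG X) -> id_factors G X.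
Proof.
have [l lE] := genG.
move=> /fgproj_id_factors[k kE].
pose rx (x : X) (v : factors G A^o) : homG X := scale_lin x \o v.2.
pose t (u : factors (E^o) (homG X)) (x : X) : G :=
  \sum_(v <- l) (u.1 (rx x v) : {linear G -> G}) (v.1 1).
have tL u : linear (t u).
  move=> c x y.
  pose e (v w : factors G A^o) : E :=
    (scale_lin (c *: w.1 1) \o v.2 : {linear G -> G}).
  have rxE v : rx (c *: x + y) v = \sum_(w <- l) e v w *: rx x w + rx y v.
    apply: linP => g; rewrite [RHS]/(homG_fun (\sum_(w <- l) e v w *: rx x w) g + v.2 g *: y).
    rewrite homG_sum /= scalerDr scalerA; congr (_ + _).
    under eq_bigr do rewrite !linearZ -!scalerA.
    by rewrite -scaler_sumr -scaler_sumr -scaler_suml lE scale1r scalerA.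
  have -> : t u (c *: x + y) = \sum_(v <- l) (\sum_(w <- l)
      (u.1 (rx x w) : {linear G -> G}) (v.2 (v.1 1) *: (c *: w.1 1)) +
      (u.1 (rx y v) : {linear G -> G}) (v.1 1)).
    apply: eq_bigr => v _; rewrite rxE linearD linear_sum.
    rewrite [LHS]/(homG_fun (\sum_(w <- l) u.1 (e v w *: rx x w)) (v.1 1) + _).
    rewrite homG_sum; congr (_ + _); apply: eq_bigr => w _; rewrite linearZ //.
  rewrite big_split exchange_big /=; congr (_ + _).
  rewrite scaler_sumr; apply: eq_bigr => w _.
  by rewrite -linear_sum -scaler_suml lE scale1r linearZ.
exists [seq ((lin_of (tL u), (u.2 1 : {linear G -> X}))) | u : factors E^o (homG X) <- k].
move=> x; rewrite big_map /=.
transitivity (\sum_(v <- l) rx x v (v.1 1)); last first.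
  by rewrite /= -scaler_suml lE scale1r.
under eq_bigr do rewrite linear_sum.
rewrite exchange_big; apply: eq_bigr => v _ /=.
have /(congr1 (fun h : homG X => homG_fun h (v.1 1))) := kE (rx x v).
rewrite homG_sum => h; apply: (etrans _ h); apply: eq_bigr => u _.
by rewrite [u.2 (u.1 _)]regular_lin.
Qed.

Lemma homG_map_surj X Z (q : {linear X -> Z}) :
  (forall h : homG Z, exists g, homG_map q g = h) ->
    forall z, exists x, q x = z.
Proof.
move=> qs z; have [r ->] := generator_trace z.
exists (\sum_(u <- r) homG_fun (xget 0 [set g | homG_map q g = u.1]) u.2).
rewrite linear_sum; apply: eq_bigr => u _; case: xgetP => [g _ <- //|nog].
by have [g gE] := qs u.1; case: (nog g).
Qed.

Lemma homG_ses K X Y (i : {linear K -> X}) (p : {linear X -> Y}) :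
  injective i -> (forall x, p x = 0 <-> exists y, i y = x) ->
  injective (homG_map i) /\
  (forall x, homG_map p x = 0 <-> exists y, homG_map i y = x).
Proof.
move=> ii ex; split.
  move=> f g fg; apply: linP => x; apply: ii.
  exact: (congr1 (fun h : homG X => homG_fun h x) fg).
move=> h; split=> [ph|[g <-]].
  have [x|g gE] := factor_inj (f := homG_fun h) ii.
    by apply/ex; exact: (congr1 (fun h : homG Y => homG_fun h x) ph).
  by exists g; apply: linP.
by apply: linP => x; apply/ex; exists (homG_fun g x).
Qed.

(** Hom(G, Z) is the kernel of a map between finitely generated projective
    modules over End(G)^op, so it is a second syzygy of a cokernel whose
    projective dimension is at most three, and has projective dimension at most
    one. Generators of Hom(G, Z) define q : G^n -> Z; the module Hom(G, L) of
    its kernel L is projective, that is, L belongs to add G. *)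
Lemma add_resolution X1 X0 (d : {linear X1 -> X0})
    (sZ : submodule [set x | d x = 0]) :
  (forall C : lmodType E, fin_gen C -> fpd 3 C) ->
  id_factors G X1 -> id_factors G X0 ->
  exists n L (i : {linear L -> {ffun 'I_n -> G}})
    (q : {linear {ffun 'I_n -> G} -> submod sZ}),
    ses i q /\ id_factors G L.
Proof.
move=> gd aX1 aX0; set Z := submod sZ.
pose B := [set y | exists x, homG_map d x = y].
have sB : submodule B := range_submodule (homG_map d).
have fX0 := homG_fgproj aX0; have fX1 := homG_fgproj aX1.
have fC : fpd 3 (quotmod sB).
  apply: gd; apply: (surj_fin_gen (p := quot_lin sB) _ fX0.1) => y.
  by exists (quot_rep y); exact: quot_piK.
have fB : fpd 2 (submod sB).
  apply: (fpd_syzygy (i := submod_lin sB) (p := quot_lin sB) fC) fX0.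
  split=> [x y /submod_inj //|y|x]; first by exists (quot_rep y);
    exact: quot_piK.
  rewrite quot_lin_eq0; split=> [Bx|[y <-]]; first by exists (to_submod sB Bx).
  exact: submod_in y.
have [|dB dBE] := submod_corestrict sB (f := homG_map d); first by move=> x;
  exists x.
have dex x : d x = 0 <-> exists y, submod_lin (sZ) y = x.
  by split=> [dx|[y <-]]; [exists (to_submod sZ dx)|exact: (submod_in y)].
have [|zi zex] := homG_ses _ dex; first by move=> x y /submod_inj.
have fK : fpd 1 (homG Z).
  apply: (fpd_syzygy (i := homG_map (submod_lin (sZ))) (p := dB) fB) fX1.
  split=> // [[y By]|x].
    by have [x xy] := By; exists x; apply: submod_inj; rewrite dBE.
  rewrite -zex -dBE; split=> [->//|h]; exact: submod_inj.
have [n [g gE]] : fin_gen (homG Z).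
  by case: fK => Q [K [i [p [[fQ _] [_ ps _] _]]]]; apply: surj_fin_gen ps fQ.
have qL : linear (fun c : {ffun 'I_n -> G} => \sum_j homG_fun (g j) (c j)).
  move=> a x y; rewrite scaler_sumr -big_split; apply: eq_bigr => j _.
  by rewrite !ffunE linearP.
pose q := lin_of qL.
have qs (h : homG Z) : exists f, homG_map q f = h.
  have [c ->] := gE h.
  have fL : linear (fun x => [ffun j => (c j : {linear G -> G}) x]).
    by move=> a x y; apply/ffunP => j; rewrite !ffunE linearP.
  exists (lin_of fL : homG _); apply: linP => x.
  rewrite [RHS]homG_sum; apply: eq_bigr => j _; by rewrite ffunE.
exists n, (submod (ker_submodule q)), (submod_lin (ker_submodule q)), q.
have sq : ses (submod_lin (ker_submodule q)) q.
  split=> [x y /submod_inj //||x]; first exact: homG_map_surj.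
  by split=> [qx|[y <-]];
    [exists (to_submod (ker_submodule q) qx)|exact: (submod_in y)].
split=> //; apply: homG_fgproj_add.
have [inj _ ex] := sq; have [hi hex] := homG_ses inj ex.
apply: (fpd_syzygy (n := 0) fK (i := homG_map (submod_lin (ker_submodule q)))
  (p := homG_map q)) => //.
exact/homG_fgproj/id_factors_power.
Qed.

End HomFunctor.

(** * Numerical dimensions and the rank argument *)

Section Dimensions.
Local Open Scope ereal_scope.

Lemma succ_le_ereal (n : nat) (d : \bar int) : ~~ (d <= n%:Z%:E) ->
  n.+1%:Z%:E <= d.
Proof.
case: d => [z| |]; [|by rewrite leey|by rewrite leNye].
by rewrite !lee_fin -ltNge intS lez1D.
Qed.

(** If all elements of D were larger than n, then n + 1 would be a lower bound.
    The default value +oo of an empty set or of a missing infimum is excluded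
    by the hypothesis. *)
Lemma infimum_le (D : set (\bar int)) (n : nat) : infimum +oo D <= n%:Z%:E ->
  exists2 d, D d & d <= n%:Z%:E.
Proof.
rewrite /infimum; case: ifP => [_|_]; first by rewrite leye_eq.
case: xgetP => [i _ [lb glb] le_in|_]; last by rewrite leye_eq.
apply: contrapT => no; have : n.+1%:Z%:E <= i.
  apply: (glb n.+1%:Z%:E) => d Dd; apply: succ_le_ereal; apply/negP => dn.
  by apply: no; exists d.
by move=> /le_trans/(_ le_in); rewrite lee_fin lez_nat ltnn.
Qed.

Lemma infimum_ge0 (D : set (\bar int)) : (forall d, D d -> 0 <= d) ->
  0 <= infimum +oo D.
Proof.
move=> D0; rewrite /infimum; case: ifP => [_|_]; first exact: leey.
by case: xgetP => [i _ [lb glb]|_]; [exact: (glb 0 D0)|exact: leey].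
Qed.

(** The default value 0 would satisfy the bound vacuously, so the existence of
    a supremum matters: it is the least natural number above D, or +oo if there
    is none. *)
Lemma supremum_le (D : set (\bar int)) (n : nat) : (forall d, D d -> 0 <= d) ->
  supremum 0 D <= n%:Z%:E -> forall d, D d -> d <= n%:Z%:E.
Proof.
move=> D0; rewrite /supremum; case: ifP => [/eqP-> _ d []|_].
case: xgetP => [i _ [ub _] le_in d Dd|nosup _ d Dd];
  first exact: le_trans (ub d Dd) le_in.
exfalso; have [[N ubN]|nob] := pselect (exists N : nat, ubound D N%:Z%:E).
  have exN : exists N : nat, `[< ubound D N%:Z%:E >] by exists N; apply/asboolP.
  case: (ex_minnP exN) => m /asboolP ubm minm; apply: (nosup m%:Z%:E);
    split=> //.
  move=> [z| |] ubz; [|exact: leey|].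
    have z0 : (0 <= z)%R by have := le_trans (D0 d Dd) (ubz d Dd);
      rewrite lee_fin.
    case: z z0 ubz => // k _ ubk; rewrite lee_fin lez_nat; apply: minm;
      exact/asboolP.
  by have := le_trans (D0 d Dd) (ubz d Dd); rewrite leeNy_eq.
apply: (nosup +oo); split=> [x _|[z| |] ubz //]; first exact: leey.
  have z0 : (0 <= z)%R by have := le_trans (D0 d Dd) (ubz d Dd);
    rewrite lee_fin.
  by case: z z0 ubz => // k _ ubk; case: nob; exists k.
by have := le_trans (D0 d Dd) (ubz d Dd); rewrite leeNy_eq.
Qed.

Lemma proj_dim_ge0 (A : pzRingType) (M : lmodType A) : 0 <= proj_dim M.
Proof. by apply: infimum_ge0 => _ [n _ <-]; rewrite lee_fin. Qed.

Lemma global_dim_fpd (A : pzRingType) (n : nat) : global_dim A <= n.+1%:Z%:E ->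
  forall M : lmodType A, fin_gen M -> fpd n.+1 M.
Proof.
move=> gd M fM; have : proj_dim M <= n.+1%:Z%:E.
  apply: (supremum_le _ gd) => [_ [N _ ->]|]; first exact: proj_dim_ge0.
  by exists M.
move=> /infimum_le[_ [m [P Pm] <-]]; rewrite lee_fin lez_nat => mn.
by apply: (res_fpd (P := P)) => i ni; apply: Pm; exact: leq_ltn_trans ni.
Qed.

End Dimensions.

(** The spans of the tails of a sequence in a finite-dimensional space
    are eventually constant. If the conclusion failed for arbitrarily
    large n, there would be r + 1 indices n_i and columns g_i for which
    the matrix of the w_(n_i) g_j is triangular with nonzero diagonal,
    yet of rank at most r. *)
Lemma rank_stationary (r : nat) (w : nat -> 'rV[rat]_r) :
  exists N, forall n (g : 'cV[rat]_r), (N <= n)%N ->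
    (forall m, (n < m)%N -> w m *m g = 0) -> w n *m g = 0.
Proof.
apply: contrapT => /forallNP bad.
have /choice[s sP] (N : nat) : exists ng : nat * 'cV[rat]_r,
    [/\ (N <= ng.1)%N, (forall m, (ng.1 < m)%N -> w m *m ng.2 = 0) &
      w ng.1 *m ng.2 <> 0].
  apply: contrapT => no; apply: (bad N) => n g Nn wg; apply: contrapT => wn.
  by apply: no; exists (n, g).
pose t k := iter k (fun u => s u.1.+1) (s 0%N).
have t0 k : w (t k).1 *m (t k).2 <> 0 /\ forall m, ((t k).1 < m)%N ->
  w m *m (t k).2 = 0.
  by case: k => [|k]; [have [] := sP 0%N|have [] := sP (t k).1.+1].
have tlt k l : (k < l)%N -> ((t k).1 < (t l).1)%N.
  elim: l => // l IH; rewrite ltnS leq_eqVlt => /orP[/eqP->|/IH kl].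
    by have [] := sP (t l).1.+1.
  by apply: ltn_trans kl _; have [] := sP (t l).1.+1.
pose W : 'M[rat]_(r.+1, r) := \matrix_(i < r.+1) w (t i).1.
pose H : 'M[rat]_(r, r.+1) := \matrix_(i, j) (t j).2 i 0.
have WH i j : (W *m H) i j = (w (t i).1 *m (t j).2) 0 0.
  by rewrite !mxE; apply: eq_bigr => k _; rewrite !mxE.
have trig : is_trig_mx (W *m H)^T.
  apply/is_trig_mxP => i j ij; rewrite mxE WH.
  by have [_ ->] := t0 i; rewrite ?mxE // tlt.
have full : (W *m H)^T \in unitmx.
  rewrite unitmxE det_trig // unitfE; apply/prodf_neq0 => i _; rewrite mxE WH.
  apply/eqP => e; have [nz _] := t0 i; apply: nz.
  by apply/matrixP => a b; rewrite !ord1 e mxE.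
have := mxrank_unit full; rewrite mxrank_tr => rk.
by have := leq_trans (mxrankM_maxl W H) (rank_leq_col W); rewrite rk ltnn.
Qed.

(** * Lengths of Ext groups *)

Section Ext.
Variables (R : comPzRingType) (A : pzRingType) (phi : {rmorphism R -> A}).
Hypothesis artA : artin_algebra phi.
Variables (M : lmodType A) (P : proj_resolution M).
Implicit Types N K Q X Y Z L : lmodType A.

Let cphi : forall r a, phi r * a = a * phi r.
Proof. by case: artA. Qed.

Local Notation cochain j N := (homR (P j) N cphi).

Definition cocycles j N : set (cochain j.+1 N) :=
  [set f | forall x, hom_fun f (res_diff P j.+1 x) = 0].

Definition coboundaries j N : set (cochain j.+1 N) :=
  [set f | exists g : {linear P j -> N}, forall x, hom_fun f x = g (res_diff P j x)].

(** Ext^(j+1)(M, N) = 0, computed on the resolution P. *)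
Definition ext0 j N := @cocycles j N `<=` @coboundaries j N.

(** The length over R of Ext^(j+1)(M, N). *)
Definition extlen j N := len (@coboundaries j N) (@cocycles j N).

Lemma cocycles_submodule j N : submodule (@cocycles j N).
Proof.
split=> [x //|a f g cf cg x].
have -> : hom_fun (a *: f + g) (res_diff P j.+1 x) =
  phi a *: hom_fun f (res_diff P j.+1 x) + hom_fun g (res_diff P j.+1 x) by [].
by rewrite cf cg scaler0 addr0.
Qed.

Lemma coboundaries_submodule j N : submodule (@coboundaries j N).
Proof.
split=> [|a f g [f' f'E] [g' g'E]]; first by exists \0.
have hL : linear (fun x => phi a *: f' x + g' x).
  move=> b x y; rewrite !linearP !scalerDr !scalerA cphi -!addrA.
  by congr (_ + _); rewrite addrCA.
by exists (lin_of hL) => x /=; rewrite -f'E -g'E.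
Qed.

Lemma coboundaries_sub j N : @coboundaries j N `<=` @cocycles j N.
Proof. by move=> f [g gE] x; rewrite gE diffK linear0. Qed.

Lemma cocycles_fin_len j N : fin_gen N ->
  fin_len (@coboundaries j N) (@cocycles j N).
Proof.
move=> fN.
have fl := hom_fin_len cphi artA (res_fin_gen P j.+1) fN.
apply: (fin_len_sub (U' := setT)) => //.
apply: (fin_len_super (W := [set 0])) fl => //;
  first exact: coboundaries_submodule.
by move=> _ ->; apply: (sub0 (@coboundaries_submodule j N)).
Qed.

Fact cochain_map_linear j N N' (u : {linear N -> N'}) :
  linear (fun f : cochain j N => (u \o hom_fun f : cochain j N')).
Proof.
by move=> a f g; apply: linP => x; exact: (linearP u (phi a) (hom_fun f x)).
Qed.
Definition cochain_map j N N' (u : {linear N -> N'}) :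
  {linear cochain j N -> cochain j N'} := lin_of (@cochain_map_linear j N N' u).

Lemma cocycles_map j N N' (u : {linear N -> N'}) f :
  @cocycles j N f -> @cocycles j N' (cochain_map j.+1 u f).
Proof. by move=> cf x; exact: etrans (congr1 u (cf x)) (linear0 u). Qed.

Lemma coboundaries_map j N N' (u : {linear N -> N'}) f :
  @coboundaries j N f -> @coboundaries j N' (cochain_map j.+1 u f).
Proof.
move=> [g gE]; exists (u \o g) => x; exact: (congr1 u (gE x)).
Qed.

Lemma ext0_len j N : ext0 j N -> extlen j N = 0%N.
Proof. exact: len_triv. Qed.

Lemma len_ext0 j N : fin_gen N -> extlen j N = 0%N -> ext0 j N.
Proof.
move=> fN; apply: len_eq0;
  [exact: coboundaries_submodule|exact: cocycles_fin_len|].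
exact: coboundaries_sub.
Qed.

Lemma ext0_id_factors j N Q : ext0 j N -> id_factors N Q -> ext0 j Q.
Proof.
move=> eN [l lE] f cf.
have /choice[g gE] (u : factors N Q) : exists g : {linear P j -> N},
    forall x, u.1 (hom_fun f x) = g (res_diff P j x).
  exact: (eN _ (cocycles_map u.1 cf)).
exists (lin_of (comb_linear l (fun u => u.2 \o g u))) => x /=.
by rewrite -[LHS]lE; apply: eq_bigr => u _; rewrite gE.
Qed.

Section LongExactSequence.
Variables (K Q X : lmodType A) (i : {linear K -> Q}) (p : {linear Q -> X}).
Hypothesis ipX : ses i p.
(** Exactness at Ext^(j+2)(M, K): the kernel of the map to Ext^(j+2)(M, Q) is a
    quotient of Ext^(j+1)(M, X). *)
Lemma ext_inj j f : ext0 j X ->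
  @coboundaries j.+1 Q (cochain_map j.+2 i f) ->
  @coboundaries j.+1 K f.
Proof.
case: ipX => ii ps pe extX [g gE].
have {}gE x : i (hom_fun f x) = g (res_diff P j.+1 x) := gE x.
have [x|k kE] := extX (p \o g : cochain j.+1 X).
  have : p (g (res_diff P j.+1 x)) = 0 by rewrite -gE; apply/pe;
    exists (hom_fun f x).
  exact.
have {}kE x : p (g x) = k (res_diff P j x) := kE x.
have [k' k'E] : exists k' : {linear P j -> Q}, forall x, p (k' x) = k x.
  by apply: (proj_lift (f := k)) => //; exact: res_projective.
have [x|g' g'E] := factor_inj (i := i) (f := g \- (k' \o res_diff P j)) ii.
  by apply/pe; rewrite linearB /= k'E kE subrr.
exists g' => x; apply: ii; rewrite g'E gE /= diffK linear0; exact/esym/subr0.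
Qed.

(** Exactness at Ext^(j+1)(M, Q). *)
Lemma ext_surj j f : ext0 j X -> @cocycles j Q f ->
  exists2 f', @cocycles j K f' &
  @coboundaries j Q (f - cochain_map j.+1 i f').
Proof.
case: ipX => ii ps pe extX cf.
have [g gE] := extX _ (cocycles_map p cf).
have {}gE x : p (hom_fun f x) = g (res_diff P j x) := gE x.
have [g' g'E] : exists g' : {linear P j -> Q}, forall x, p (g' x) = g x.
  by apply: (proj_lift (f := g)) => //; exact: res_projective.
have [x|f' f'E] := factor_inj (i := i) (f :=
  hom_fun f \- (g' \o res_diff P j)) ii.
  by apply/pe; rewrite linearB /= g'E gE subrr.
exists f' => [x|].
  by apply: ii; rewrite [hom_fun f' _]/(f' _) f'E /= cf diffK !linear0;
    exact: addr0.
exists g' => x; rewrite [LHS]/(hom_fun f x - i (f' x)) f'E; exact: subKr.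
Qed.

Lemma ext0_ses j : ext0 j X -> ext0 j.+1 Q -> ext0 j.+1 K.
Proof. by move=> eX eQ f cf; apply: ext_inj => //; apply/eQ/cocycles_map. Qed.

Lemma extlen_ses j : ext0 j X -> ext0 j.+1 X -> fin_gen K ->
  extlen j.+1 K = extlen j.+1 Q.
Proof.
move=> eX eX' fK.
have sCK := @cocycles_submodule j.+1 K; have sCQ := @cocycles_submodule j.+1 Q.
have sBQ := @coboundaries_submodule j.+1 Q.
have BCK := @coboundaries_sub j.+1 K; have BCQ := @coboundaries_sub j.+1 Q.
apply: (len_bij sCK sBQ sCQ BCK BCQ (f := cochain_map j.+2 i)).
- by move=> f; apply: cocycles_map.
- by move=> f; apply: coboundaries_map.
- by move=> f; apply: ext_surj.
- by move=> f _; apply: ext_inj.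
- exact: cocycles_fin_len.
Qed.

Lemma extlen_ses_inj j : ext0 j X -> fin_gen K -> extlen j K = extlen j Q ->
  forall f, @cocycles j K f -> @coboundaries j Q (cochain_map j.+1 i f) ->
  @coboundaries j K f.
Proof.
move=> eX fK lKQ.
have sCK := @cocycles_submodule j K; have sCQ := @cocycles_submodule j Q.
have sBK := @coboundaries_submodule j K; have sBQ :=
  @coboundaries_submodule j Q.
have BCK := @coboundaries_sub j K; have BCQ := @coboundaries_sub j Q.
apply: (len_surj_eq sBK sCK sBQ sCQ BCK BCQ (f := cochain_map j.+1 i)).
- by move=> f; apply: coboundaries_map.
- by move=> f; apply: ext_surj.
- exact: cocycles_fin_len.
- exact/esym.
Qed.

End LongExactSequence.

Section Additivity.
Variable j : nat.

(** Filter the cocycles with values in Y * Z by those whose first component is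
    a coboundary. *)
Lemma extlen_additive : additive_fun (extlen j).
Proof.
split=> [X X0|X Y Z fX [u [v uK vK]]].
  by apply: ext0_len => f cf; exists \0 => x; rewrite /= [LHS]X0.
have vL : linear v by move=> a x y; apply: (can_inj uK); rewrite linearP !vK.
pose p1 : {linear X -> Y} := fst_lin Y Z \o u.
pose p2 : {linear X -> Z} := snd_lin Y Z \o u.
pose s1 : {linear Y -> X} := lin_of vL \o inl_lin Y Z.
pose s2 : {linear Z -> X} := lin_of vL \o inr_lin Y Z.
have ps1 y : p1 (s1 y) = y by rewrite /= vK.
have ps2 z : p2 (s2 z) = z by rewrite /= vK.
have p1s2 z : p1 (s2 z) = 0 by rewrite /= vK.
have sp x : x = s1 (p1 x) + s2 (p2 x).
  apply: (can_inj uK); rewrite linearD /= !vK [RHS]/(_ + _) /= /add_pair /=.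
  by rewrite addr0 add0r -surjective_pairing.
pose T := @cocycles j X `&` [set f | @coboundaries j Y (cochain_map j.+1 p1 f)].
have sC := @cocycles_submodule j X; have sB := @coboundaries_submodule j X.
have sCY := @cocycles_submodule j Y; have sBY := @coboundaries_submodule j Y.
have sCZ := @cocycles_submodule j Z; have sBZ := @coboundaries_submodule j Z.
have BC := @coboundaries_sub j X; have BCY := @coboundaries_sub j Y.
have BCZ := @coboundaries_sub j Z.
have sT : submodule T.
  by apply: cap_submodule => //;
    apply: (preimage_submodule (cochain_map j.+1 p1)).
have BT : @coboundaries j X `<=` T.
  by move=> f Bf; split; [apply: BC|apply: coboundaries_map].
have TC : T `<=` @cocycles j X by move=> f [].
have fl := @cocycles_fin_len j X fX.
rewrite /extlen (len_add sT sC BT TC fl) addnC; congr (_ + _)%N.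
  apply: (len_bij sC sBY sCY TC BCY (f := cochain_map j.+1 p1)).
  - by move=> f; apply: cocycles_map.
  - by move=> f [].
  - move=> h ch; exists (cochain_map j.+1 s1 h); first exact: cocycles_map.
    rewrite (_ : h - _ = 0); first exact: sub0.
    by apply: linP => x; rewrite [LHS]/(hom_fun h x - p1 (s1 (hom_fun h x))) ps1; exact: subrr.
  - by move=> f Cf Bf; split.
  - exact: fin_len_super sC sT BT TC fl.
apply: (len_bij sT sBZ sCZ BT BCZ (f := cochain_map j.+1 p2)).
- by move=> f [cf _]; apply: cocycles_map.
- by move=> f; apply: coboundaries_map.
- move=> h ch; exists (cochain_map j.+1 s2 h).
    split; first exact: cocycles_map.
    by exists \0 => x; exact: p1s2.
  rewrite (_ : h - _ = 0); first exact: sub0.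
  by apply: linP => x; rewrite [LHS]/(hom_fun h x - p2 (s2 (hom_fun h x))) ps2;
    exact: subrr.
- move=> f [_ B1] B2.
  have -> : f = cochain_map j.+1 s1 (cochain_map j.+1 p1 f) +
      cochain_map j.+1 s2 (cochain_map j.+1 p2 f).
    by apply: linP => x; exact: sp.
  by apply: subD => //; apply: coboundaries_map.
exact: fin_len_sub TC fl.
Qed.

End Additivity.

(** This cocycle represents the class of the identity of the syzygy. *)
Lemma syz_pi_cocycle k : @cocycles k (syz P k) (syz_pi P k).
Proof. by move=> x; apply/syz_pi_eq0; exact: diffK. Qed.

(** If the class of the identity of the syzygy vanishes, the identity extends
    to P k. *)
Lemma syz_split k : ext0 k (syz P k) ->
  exists g : {linear P k -> syz P k}, forall z, g (syz_in P k z) = z.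
Proof.
move=> /(_ _ (@syz_pi_cocycle k))[g gE]; exists g => z.
by have [x <-] := syz_pi_surj z; rewrite syz_piE -gE.
Qed.

(** The obstruction to lifting the identity of the syzygy along q is its image
    in Ext^(k+2)(M, L) under the connecting map, and this image dies in
    Ext^(k+2)(M, Q). *)
Lemma syz_retract k L Q (i : {linear L -> Q}) (q : {linear Q -> syz P k}) : ses i q ->
  (forall f, @cocycles k.+1 L f ->
    @coboundaries k.+1 Q (cochain_map k.+2 i f) ->
     @coboundaries k.+1 L f) ->
  retract (syz P k) Q.
Proof.
move=> [ii qs qe] inj.
have [h hE] : exists h : {linear P k.+1 -> Q}, forall x, q (h x) = syz_pi P k x.
  by apply: proj_lift => //; exact: res_projective.
have [x|f fE] := factor_inj (i := i) (f := h \o res_diff P k.+1) ii.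
  by apply/qe; rewrite /= hE; apply: syz_pi_cocycle.
have [||g gE] := inj f.
- by move=> x; apply: ii; rewrite [hom_fun f _]/(f _) fE /= diffK !linear0.
- by exists h => x; exact: fE.
have {}gE x : f x = g (res_diff P k.+1 x) := gE x.
have [||s sE] := @factor_surj _ _ _ _ (syz_pi P k) (h \- (i \o g)).
- exact: syz_pi_surj.
- move=> x /syz_pi_eq0 dx; have [y <-] := (@cycleP _ _ P k.+1 x).1 dx.
  by rewrite /= -gE fE; exact: subrr.
exists s, q => z; have [x <-] := syz_pi_surj z.
rewrite sE linearB /= hE (_ : q (i (g x)) = 0) ?subr0 //.
by apply/qe; exists (g x).
Qed.

End Ext.

Lemma ses_split (A : pzRingType) (K Q X : lmodType A) (i : {linear K -> Q})
    (p : {linear Q -> X}) (g : {linear Q -> K}) :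
  ses i p -> (forall x, g (i x) = x) -> retract X Q.
Proof.
move=> [ii ps pe] gi.
have [x /pe[y <-]|s sE] := @factor_surj _ _ _ _ p (idfun \- (i \o g)) ps.
  by rewrite /= gi; exact: subrr.
exists s, p => z; have [x <-] := ps z; rewrite sE linearB /=.
by rewrite (_ : p (i (g x)) = 0) ?subr0 //; apply/pe; exists (g x).
Qed.

(** * The Auslander-Reiten conjecture *)

(** The indecomposable summands of the regular module are projective. *)
Lemma generator_regular (R : comPzRingType) (A : pzRingType)
    (phi : {rmorphism R -> A}) (G : lmodType A) :
  artin_algebra phi -> generator_cogenerator G -> id_factors G A^o.
Proof.
move=> artA [_ genG _].
have aA : id_factors A^o A^o by apply: id_factors_self.
have fpA : fgproj (A^o : lmodType A) by apply/fgproj_id_factors.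
have [s [sA inds]] := indec_decomposition (fin_gen_fin_len artA fpA.1).
apply: (direct_sum_id_factors sA) => Y Ys.
have [fY pY] := fgproj_retract (direct_sum_retract sA Ys) fpA.
by apply/in_add_id_factors/genG => //; apply: inds.
Qed.

Theorem mainTheorem2 (R : comPzRingType) (A : pzRingType)
    (phi : {rmorphism R -> A}) :
  artin_algebra phi ->
  (rep_dim A <= 3%:Z%:E)%E ->
  forall M : lmodType A,
    fin_gen M ->
    (forall i : nat, (0 < i)%N -> ext_vanishes i M (M * A^o)%type) ->
    projective M.
Proof.
move=> artA /infimum_le[_ [G genG ->] gdG] M fM extM.
have genA := generator_regular artA genG.
have [fG _ _] := genG.
have gd := global_dim_fpd gdG.
have [P _] := extM 1%N isT.
have ext_sum j : ext0 artA P j (M * A^o)%type.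
  by move=> f cf; apply: (ext_vanishes_res (extM j.+1 isT) cf).
have ext_M j : ext0 artA P j M.
  apply: ext0_id_factors (ext_sum j) _.
  exists [:: (inl_lin M A^o, fst_lin M A^o)] => x; exact: big_seq1.
have ext_A j : ext0 artA P j A^o.
  apply: ext0_id_factors (ext_sum j) _.
  exists [:: (inr_lin M A^o, snd_lin M A^o)] => x; exact: big_seq1.
have ext_proj j Q : fgproj Q -> ext0 artA P j Q.
  by move=> /fgproj_id_factors; apply: ext0_id_factors.
have ext_syz k j : (k < j)%N -> ext0 artA P j (syz P k).
  elim: k j => [|k IH] [//|j] kj.
    by apply: (ext0_ses (syz_ses0 P)) => //; apply: ext_proj; apply: res_fgproj.
  apply: (ext0_ses (syz_ses P k)); first exact: IH.
  by apply: ext_proj; apply: res_fgproj.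
have addP k : id_factors G (P k).
  by apply: (id_factors_trans genA); apply/fgproj_id_factors/res_fgproj.
have [r [Gs rankG]] := add_finite_rank (fin_gen_fin_len artA fG).
pose w m : 'rV[rat]_r := \row_j (extlen artA P m (Gs j))%:R.
have coord X : id_factors G X -> exists a : 'cV[rat]_r,
    forall m, (w m *m a) 0 0 = (extlen artA P m X)%:R.
  move=> aX; have fX := id_factors_fin_gen aX fG.
  have [a aE] := rankG X fX (fin_gen_fin_len artA fX) aX.
  exists (\col_j (a j)%:R) => m;
    rewrite (aE _ (extlen_additive artA P m)) natr_sum mxE.
  by apply: eq_bigr => j _; rewrite !mxE -natrM mulnC.
have [N statN] := rank_stationary w.
(* Beyond N, a combination of classes of add G that is killed by all later Ext
   lengths is killed by the current one. Applied to L and G^n this makes a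
   surjection of Ext groups injective, so that the syzygy is a summand of G^n. *)
have add_syz k : (N <= k)%N -> id_factors G (syz P k.+1).
  move=> Nk.
  have [n [L [i [q [sq aL]]]]] := add_resolution genA
    (cycle_submodule P k.+1) gd (addP k.+1) (addP k).
  have aQ := id_factors_power G n.
  have [a aE] := coord _ aL; have [b bE] := coord _ aQ.
  have fL := id_factors_fin_gen aL fG.
  apply: id_factors_retract aQ; apply: (syz_retract (artA := artA) sq).
  apply: (extlen_ses_inj (artA := artA) sq) => //; first exact: ext_syz.
  have /matrixP/(_ 0 0) : w k.+2 *m (a - b) = 0.
    apply: statN => [|m km]; first by rewrite leqW // leqW.
    apply/matrixP => x y;
      rewrite !ord1 mulmxBr mxE [in X in _ + X]mxE aE bE mxE.
    case: m km => // m km; rewrite (extlen_ses sq) ?subrr //;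
      apply: ext_syz => //.
    exact: ltnW.
  rewrite mulmxBr mxE [in X in _ + X]mxE aE bE mxE => /eqP.
  by rewrite subr_eq0 eqr_nat => /eqP.
(* The same principle for the syzygy, on which all later Ext groups vanish. *)
have proj_syz : projective (syz P N.+1).
  have aX := add_syz N (leqnn N); have fX := id_factors_fin_gen aX fG.
  have [a aE] := coord _ aX.
  have /matrixP/(_ 0 0) : w N.+1 *m a = 0.
    apply: statN => // m Nm; apply/matrixP => x y; rewrite !ord1 aE mxE.
    by rewrite ext0_len //; apply: ext_syz.
  rewrite aE mxE => /eqP; rewrite pnatr_eq0 => /eqP e0.
  have [g gE] := syz_split (len_ext0 fX e0).
  by apply: (@retract_projective _ _ (P N.+1));
    [exists (syz_in P N.+1), g|exact: res_projective].
have fpsyz : fgproj (syz P N.+1) by split=> //; apply: syz_fin_gen.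
(* Ext(M, -) vanishes on projectives, so a projective syzygy is a summand of the
   preceding term of the resolution, with the preceding syzygy as complement. *)
have down k : fgproj (syz P k.+1) -> fgproj (syz P k).
  move=> fp; have [g gE] := syz_split (ext_proj k.+1 _ fp).
  exact: fgproj_retract (ses_split (syz_ses P k) gE) (res_fgproj P k.+1).
have fp0 : fgproj (syz P 0) by elim: N.+1 fpsyz => // k IH /down.
have [g gE] := syz_split (ext_proj 0%N _ fp0).
apply: retract_projective (ses_split (syz_ses0 P) gE) _.
exact: res_projective.
Qed.
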